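(* Let $\xi=(\xi_n)_{n\in\mathbb Z_+}$, $\xi_n=(X_n,\eta_n)$, be the time-homogeneous Markov process on the half-strip $\Sigma=\mathbb R_+\times S$ described in the context, with kernel $\mathcal K_s$. Suppose the following. (1) (Non-confinement) $\Pr(\limsup_{n\to\infty}X_n=\infty)=1$. (2) (Limiting kernel) $\mathcal K:S\times\mathcal B(S)\to[0,1]$ is a Markov kernel on $S$ that has a unique invariant probability measure $\pi\in\mathcal P(S)$, and $u\mapsto\mathcal K(u,\cdot)$ is continuous from $(S,d_S)$ to $(\mathcal P(S),d_{\mathrm{TV}})$. (3) (Asymptotic Markovianity) $\lim_{x\to\infty}\sup_{u\in S}\|\mathcal K_s^\circ(x,u,\cdot)-\mathcal K(u,\cdot)\|_{\mathrm{TV}}=0$. (4) (Moments) There are constants $p>2$, $q>0$, $x_B\in\mathbb R_+$ and $B_p,B_q<\infty$ such that, for all $n\in\mathbb Z_+$, $\mathbb E[|X_{n+1}-X_n|^p\mid\mathcal F_n]\le B_p$ on $\{X_n\ge x_B\}$ and $\mathbb E[|X_{n+1}|^q\mid\mathcal F_n]\le B_q$ on $\{X_n<x_B\}$. (5) (Strict Lamperti regime) There are $e,\sigma^2\in C_b(S)$ (values at $u$ written $e_u$, $\sigma_u^2$) such that, as $x\to\infty$, $\sup_{u\in S}|\mu_1(x,u)-\frac{e_u}{x}|=o(x^{-1})$ and $\sup_{u\in S}|\mu_2(x,u)-\sigma_u^2|=o(1)$. For $\theta\in\mathbb R$ set $\delta_\theta:=\int_S(2e_u+(2\theta-1)\sigma_u^2)\,\pi(du)$.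 Then: (a) $\xi$ is transient if $\delta_0>0$ and recurrent if $\delta_0<0$. (b) If, moreover, $q\ge2$, then $\xi$ is positive recurrent if $\delta_1<0$, while $\xi$ is null recurrent if $\delta_0<0<\delta_1$.
   Context: Notation: $\mathbb R_+=[0,\infty)$, $\mathbb Z_+=\{0,1,2,\dots\}$. $(S,d_S)$ is a compact metric space with Borel sets $\mathcal B(S)$; $\mathcal P(S)$ is the set of Borel probability measures on $S$; $C_b(S)$ is the set of continuous real functions on $S$. $\|\cdot\|_{\mathrm{TV}}$ is the total variation norm on finite signed Borel measures, $\|\nu\|_{\mathrm{TV}}=\sup\{\int f\,d\nu: f\in C_b(S),\ \sup|f|\le1\}$, and $d_{\mathrm{TV}}(\mu,\nu)=\frac12\|\mu-\nu\|_{\mathrm{TV}}$. A probability $\nu\in\mathcal P(S)$ is invariant for a Markov kernel $\mathcal K$ if $\nu(B)=\int_S\nu(du)\mathcal K(u,B)$ for all $B\in\mathcal B(S)$. The process: on a probability space with filtration $(\mathcal F_n)_{n\in\mathbb Z_+}$, $\xi=(\xi_n)$ is an adapted process in $\Sigma=\mathbb R_+\times S$ with $\xi_n=(X_n,\eta_n)$, $X_n\in\mathbb R_+$, $\eta_n\in S$, and $\mathcal K_s$ is a Markov kernel on $\Sigma$ with $\Pr(\xi_{n+1}\in A\mid\mathcal F_n)=\mathcal K_s(\xi_n,A)$ a.s. for all Borel $A\subseteq\Sigma$, $n\in\mathbb Z_+$. The initial state $\xi_0=(x_0,u_0)\in\Sigma$ is deterministic but arbitrary. For $B\in\mathcal B(S)$,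 $\mathcal K_s^\circ(x,u,B):=\mathcal K_s((x,u),\mathbb R_+\times B)$. For $k\in\{1,2\}$ and $x\ge x_B$, $\mu_k(x,u):=\int_{\mathbb R_+\times S}(y-x)^k\,\mathcal K_s((x,u),d(y,v))$, so $\mathbb E[(X_{n+1}-X_n)^k\mid\mathcal F_n]=\mu_k(\xi_n)$ on $\{X_n\ge x_B\}$. Definitions: $\tau_r:=\min\{n\in\mathbb Z_+:X_n\le r\}$ ($\min\emptyset:=\infty$). $\xi$ is transient if $\lim_{n}X_n=\infty$ a.s.; recurrent if there is $r_0\in\mathbb R_+$ with $\liminf_nX_n\le r_0$ a.s.; positive recurrent if there is $r_1\in\mathbb R_+$ with $\mathbb E\tau_r<\infty$ for all $r\ge r_1$; null recurrent if for every $r\in\mathbb R_+$ there is $r_1>r$ such that $\mathbb E\tau_r=\infty$ whenever $x_0>r_1$ (a statement about the process with the given kernel started from such $x_0$). *)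

(* Defs.v *)
From HB Require Import structures.
From mathcomp Require Import all_boot all_order all_algebra.
From mathcomp Require Import all_classical all_reals all_analysis.
From mathcomp Require Import measurable_realfun.

Set Implicit Arguments.
Unset Strict Implicit.
Unset Printing Implicit Defensive.

Import Order.TTheory GRing.Theory Num.Theory.
Import numFieldNormedType.Exports.

Local Open Scope classical_set_scope.
Local Open Scope ring_scope.

(* Metric spaces whose measurable sets are the Borel sets.  Measurable types
   are pointed in the library, so such a space is nonempty. *)
HB.mixin Record isBorel d T & Topological T & Measurable d T := {
  measurable_borel : (@measurable d T : set (set T)) = <<s (@open T) >>
}.

#[short(type="borelMetricType")]
HB.structure Definition BorelMetric (d : measure_display) (K : numDomainType) :=
  { T of Metric K T & Measurable d T & isBorel d T }.

(* [0, +oo[ with the trace of the Borel sets of R. *)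
Definition half_line (R : realType) : Type := {nonneg R}.

HB.instance Definition _ (R : realType) := Choice.on (half_line R).
HB.instance Definition _ (R : realType) := isPointed.Build (half_line R) 0%:nng.
HB.instance Definition _ (R : realType) := Measurable.copy (half_line R)
  (g_sigma_algebra_preimageType (fun x : half_line R => x%:num)).

(* The product sigma-algebra on the half-strip is its Borel sigma-algebra as
   soon as S is separable, in particular when S is compact. *)
Notation half_strip R S := (half_line R * S)%type.

(* The point of the half-line with value x when 0 <= x; the values at negative
   x are irrelevant, as hl is only used for limits when x --> +oo. *)
Definition hl (R : realType) (x : R) : half_line R := `|x|%:nng.

Section total_variation.
Context (R : realType) (d : measure_display) (S : borelMetricType d R).
Local Open Scope ereal_scope.

(* The total variation norm of the signed measure mu - nu, for finite measures
   mu and nu. *)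
Definition tv_norm_sub (mu nu : set S -> \bar R) : \bar R :=
  ereal_sup [set \int[mu]_u (f u)%:E - \int[nu]_u (f u)%:E |
    f in [set f : S -> R | continuous f /\ forall u, (`|f u| <= 1)%R]].

Definition dTV (mu nu : set S -> \bar R) : \bar R :=
  2^-1%:E * tv_norm_sub mu nu.

End total_variation.

Section kernels.
Context (R : realType) (d : measure_display) (S : borelMetricType d R).
Local Open Scope ereal_scope.

Definition invariant_probability (K : R.-pker S ~> S) (nu : probability S R) :=
  forall B : set S, measurable B -> nu B = \int[nu]_u K u B.

(* Measures are compared on measurable sets only: their values on other sets
   are arbitrary. *)
Definition unique_invariant_probability (K : R.-pker S ~> S)
    (pi : probability S R) :=
  invariant_probability K pi /\
  forall nu : probability S R, invariant_probability K nu ->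
    forall B : set S, measurable B -> nu B = pi B.

Definition tv_continuous (K : R.-pker S ~> S) :=
  forall u : S, dTV (K v) (K u) @[v --> u] --> 0.

Variable Ks : R.-pker (half_strip R S) ~> (half_strip R S).

Definition marginal_kernel (x : half_line R) (u : S) : set S -> \bar R :=
  fun B => Ks (x, u) ([set: half_line R] `*` B).

Definition increment_moment (k : nat) (x : half_line R) (u : S) : \bar R :=
  \int[Ks (x, u)]_y ((y.1%:num - x%:num) ^+ k)%:E.

Definition asymptotically_markov (K : R.-pker S ~> S) :=
  ereal_sup [set tv_norm_sub (marginal_kernel (hl x) u) (K u) | u in [set: S]]
    @[x --> +oo%R] --> 0.

(* "o(1/x)" is expressed by multiplying by x. *)
Definition strict_lamperti (e sigma2 : S -> R) :=
  x%:E * ereal_sup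
    [set `|increment_moment 1 (hl x) u - (e u / x)%:E| | u in [set: S]]
    @[x --> +oo%R] --> 0 /\
  ereal_sup
    [set `|increment_moment 2 (hl x) u - (sigma2 u)%:E| | u in [set: S]]
    @[x --> +oo%R] --> 0.

End kernels.

Section processes.
Context (R : realType) (dO : measure_display) (Omega : measurableType dO)
  (P : probability Omega R).
Local Open Scope ereal_scope.

Definition filtration (F : nat -> set_system Omega) :=
  [/\ forall n, sigma_algebra setT (F n),
      forall n, F n `<=` measurable &
      forall m n, (m <= n)%N -> F m `<=` F n].

(* Y is a version of the conditional expectation of the nonnegative Z given
   the sub-sigma-algebra G. *)
Definition cond_exp_version (G : set_system Omega) (Z Y : Omega -> \bar R) :=
  (forall B : set (\bar R), measurable B -> G (Y @^-1` B)) /\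
  forall A, G A -> \int[P]_(w in A) Y w = \int[P]_(w in A) Z w.

(* E[Z | G] <= b almost surely on A, for Z nonnegative. *)
Definition cond_exp_le_on (G : set_system Omega) (Z : Omega -> \bar R)
    (b : R) (A : set Omega) :=
  exists2 Y, cond_exp_version G Z Y & {ae P, forall w, A w -> Y w <= b%:E}.

Context (d : measure_display) (S : borelMetricType d R).

Definition radial (xi : nat -> Omega -> half_strip R S) (n : nat) (w : Omega)
  : R := (xi n w).1%:num.

Record markov_process (Ks : R.-pker (half_strip R S) ~> (half_strip R S))
    (z : half_strip R S) (F : nat -> set_system Omega)
    (xi : nat -> Omega -> half_strip R S) : Prop := {
  mp_filtration : filtration F ;
  mp_adapted : forall n A, measurable A -> F n (xi n @^-1` A) ;
  mp_initial : forall w, xi 0%N w = z ;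
  mp_markov : forall n A, measurable A ->
    cond_exp_version (F n) (EFin \o \1_(xi n.+1 @^-1` A))
      (fun w => Ks (xi n w) A) }.

Definition moment_bounds (F : nat -> set_system Omega)
    (xi : nat -> Omega -> half_strip R S) (p q xB Bp Bq : R) :=
  forall n,
    cond_exp_le_on (F n)
      (fun w => (`|radial xi n.+1 w - radial xi n w| `^ p)%:E)
      Bp [set w | (xB <= radial xi n w)%R] /\
    cond_exp_le_on (F n)
      (fun w => (`|radial xi n.+1 w| `^ q)%:E)
      Bq [set w | (radial xi n w < xB)%R].

(* The first n with X_n <= r, and +oo if there is none. *)
Definition hitting_time (xi : nat -> Omega -> half_strip R S) (r : R)
    (w : Omega) : \bar R :=
  ereal_inf [set n%:R%:E | n in [set n | (radial xi n w <= r)%R]].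

End processes.

Definition delta (R : realType) (d : measure_display) (S : borelMetricType d R)
    (pi : probability S R) (e sigma2 : S -> R) (theta : R) : R :=
  \int[pi]_u (2 * e u + (2 * theta - 1) * sigma2 u).

(* The process is given as a family indexed by its deterministic initial state
   z, each member living on its own probability space.  The thresholds in the
   definitions of recurrence do not depend on z; otherwise, tau_r being 0 when
   r >= x_0, positive recurrence would always hold. *)
Section classification.
Context (R : realType) (d : measure_display) (S : borelMetricType d R)
  (dO : half_strip R S -> measure_display)
  (Omega : forall z, measurableType (dO z))
  (P : forall z, probability (Omega z) R)
  (xi : forall z, nat -> Omega z -> half_strip R S).
Arguments xi : clear implicits.
Local Open Scope ereal_scope.

Definition non_confined := forall z,
  {ae P z, forall w, limn_esup (fun n => (radial (xi z) n w)%:E) = +oo}.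

Definition transient := forall z,
  {ae P z, forall w, radial (xi z) n w @[n --> \oo] --> +oo%R}.

Definition recurrent := exists2 r0 : R, (0 <= r0)%R & forall z,
  {ae P z, forall w, limn_einf (fun n => (radial (xi z) n w)%:E) <= r0%:E}.

Definition positive_recurrent := exists2 r1 : R, (0 <= r1)%R &
  forall r, (r1 <= r)%R -> forall z,
    \int[P z]_w hitting_time (xi z) r w < +oo.

Definition null_recurrent := forall r : R, (0 <= r)%R ->
  exists2 r1 : R, (r < r1)%R & forall z, (r1 < z.1%:num)%R ->
    \int[P z]_w hitting_time (xi z) r w = +oo.

End classification.

(* Main.v *)
Require Import Defs.
From HB Require Import structures.
From mathcomp Require Import all_boot all_order all_algebra.
From mathcomp Require Import all_classical all_reals all_analysis.
From mathcomp Require Import measurable_realfun ring lra.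

Set Implicit Arguments.
Unset Strict Implicit.
Unset Printing Implicit Defensive.

Import Order.TTheory GRing.Theory Num.Theory.
Import numFieldNormedType.Exports.

Local Open Scope classical_set_scope.
Local Open Scope ring_scope.

(* For large x the radial component X behaves like a Lamperti process whose
   coefficients depend on the modulating component eta.  The dependence is
   averaged out by a corrector: the Lyapunov function is
     (1 + x)^a + (1 + x)^(a - 2) g(u),
   where g solves the Poisson equation g - K g = h - pi(h) up to a small uniform
   error, h(u) = (a / 2) (2 e_u + (a - 1) sigma2_u).  Its expected increment is
     (1 + x)^(a - 2) ((a / 2) delta_(a / 2) + o(1)).
   A small a < 0 gives transience, a small a > 0 recurrence, a = 2 gives positive
   recurrence (Foster).  For null recurrence, with a < 2 close to 2 the function
   is a submartingale outside a bounded set; if the hitting time had a finite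
   expectation, E X_n^2 would be bounded before the hitting time, and the
   submartingale, which is uniformly integrable because a < 2, could not decrease
   to its values near the origin.
   The Poisson equation is solved approximately with Cesaro averages, which
   converge uniformly: otherwise a limit of averages along an ultrafilter would be
   an invariant probability different from pi, its countable additivity being a
   consequence of the strong Feller property of K and of Dini's theorem. *)

(** * Means and ultrafilter limits *)

(** The corrector carries the exponent a - 2 because that is the order of the drift of (1 + x)^a:
    the first derivative meets a mean increment of order 1/x, the second a bounded second moment,
    and both lose two powers. A move of eta from u changes the corrector on average by (1 + x)^(a -
    2) (K g - g)(u) to the same order, so h(u) is replaced by pi(h) = (a / 2) delta_(a / 2). As
    delta_theta is affine in theta, a strict sign of delta_0 or delta_1 persists for a near 0 or
    near 2. K may be periodic, so the Neumann series itself need not converge; averaging it leaves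
    an error epsilon, which the strict signs absorb. The total variation norm tests continuous
    functions only, while the identification of pi involves all Borel sets; a monotone class
    argument bridges the two. Jumps are not bounded: the Taylor expansion serves for increments of
    at most half of 1 + x, and larger ones are paid for by the p-th moment. The drift is controlled
    only for large x, so every criterion works on excursions above a level. *)

Section content.
Context d (T : measurableType d) (R : realType) (m : set T -> R).
Hypothesis m_ge0 : forall B, 0 <= m B.
Hypothesis m_setT : m setT = 1.
Hypothesis m_additive : forall A B, measurable A -> measurable B ->
  A `&` B = set0 -> m (A `|` B) = m A + m B.
Hypothesis m_continuous : forall B : (set T)^nat, (forall n, measurable (B n)) ->
  nonincreasing_seq B -> \bigcap_n B n = set0 -> m (B n) @[n --> \oo] --> 0.

Let mu (B : set T) : \bar R := (m B)%:E.

Let m0 : m set0 = 0.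
Proof.
have := m_additive (@measurable0 _ T) (@measurable0 _ T).
by rewrite setU0 setI0 => /(_ erefl); lra.
Qed.

Let mu0 : mu set0 = 0%E. Proof. by rewrite /mu m0. Qed.

Let mu_ge0 B : (0 <= mu B)%E. Proof. by rewrite lee_fin. Qed.

(** The tails [W n] decrease to the empty set, because a point of [F k] has left them from index k +
    1 on; continuity at the empty set then turns finite into countable additivity. *)
Let mu_sigma_additive : semi_sigma_additive mu.
Proof.
move=> F mF tF mUF.
pose U n := \big[setU/set0]_(i < n) F i.
have mU n : measurable (U n) by exact: bigsetU_measurable.
have mUn n : m (U n) = \sum_(i < n) m (F i).
  elim: n => [|n ih]; first by rewrite /U !big_ord0 m0.
  rewrite /U !big_ord_recr/= -/(U n) m_additive ?ih//.
  rewrite /U big_distrl/= big1// => i _.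
  apply: contrapT => /eqP/set0P F0.
  have := tF i n Logic.I Logic.I F0 => /eqP.
  by rewrite ltn_eqF.
pose W n := \bigcup_n F n `\` U n.
have mW n : measurable (W n) by exact: measurableD.
have W0 : m (W n) @[n --> \oo] --> 0.
  apply: m_continuous => //.
    apply/nonincreasing_seqP => n; apply/subsetPset.
    by rewrite /W /U big_ord_recr/= setDUr => x [].
  rewrite -subset0 => x Wx.
  have [[k _ Fkx] _] := Wx 0%N Logic.I.
  have [_] := Wx k.+1 Logic.I; apply.
  by rewrite /U big_ord_recr/=; right.
have E n : \sum_(i < n) m (F i) = m (\bigcup_n F n) - m (W n).
  rewrite -mUn; apply/eqP; rewrite eq_sym subr_eq -m_additive//; last first.
    by rewrite /W setDIK.
  rewrite /W setDUK// /U -bigcup_mkord.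
  by move=> x [k _ Fk]; exists k.
rewrite /mu.
under eq_fun do rewrite sumEFin.
apply/cvg_EFin; first by near=> n.
rewrite (_ : fine \o _ = (fun n => m (\bigcup_n F n) - m (W n))); last first.
  by apply/funext => n /=; rewrite big_mkord E.
rewrite -[X in _ --> X]subr0.
by apply: cvgB => //; exact: cvg_cst.
Unshelve. all: by end_near. Qed.

HB.instance Definition _ := isMeasure.Build _ _ _ mu mu0 mu_ge0 mu_sigma_additive.

Let muT : mu setT = 1%E. Proof. by rewrite /mu m_setT. Qed.

HB.instance Definition _ := Measure_isProbability.Build _ _ _ mu muT.

Lemma probability_of_content :
  exists P : probability T R, forall B, P B = (m B)%:E.
Proof. by exists mu. Qed.

End content.

Section ultrafilter_limits.
Context (R : realType) (G : set_system nat) {UG : UltraFilter G}.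

(** Compactness of [-M, M] gives a cluster point, and a cluster point of an ultrafilter is a limit:
    if the preimage of a neighbourhood were not in [G], its complement would be. *)
Lemma bounded_ultra_cvg (x : nat -> R) (M : R) : (forall n, `|x n| <= M) ->
  cvg (x @ G).
Proof.
move=> xM.
have xG : (x @ G) [set` `[- M, M]].
  apply: (@filterE _ G _ (x @^-1` [set` `[- M, M]])) => n /=.
  rewrite in_itv/= -ler_norml; exact: xM.
have [p [_ clp]] := @segment_compact R (- M) M (x @ G) _ xG.
suff h : x @ G --> (p : R) by apply/cvg_ex; exists p.
move=> V pV.
have [//|GC] := in_ultra_setVsetC (x @^-1` V) UG.
by have [y [/= ny Vy]] := clp (~` V) V GC pV.
Qed.

End ultrafilter_limits.

Section means.
Context d (T : measurableType d) (R : realType).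
Implicit Types (f g : T -> R) (L : (T -> R) -> R).

Definition bounded_measurable f :=
  measurable_fun setT f /\ exists M, forall x, `|f x| <= M.

Lemma bounded_measurable_cst c : bounded_measurable (fun=> c).
Proof. by split; [exact: measurable_cst | exists `|c|]. Qed.

Lemma bounded_measurableD f g : bounded_measurable f -> bounded_measurable g ->
  bounded_measurable (fun x => f x + g x).
Proof.
move=> [mf [M fM]] [mg [N gN]]; split; first exact: measurable_funD.
exists (M + N) => x; exact: le_trans (ler_normD _ _) (lerD (fM x) (gN x)).
Qed.

Lemma bounded_measurableM f g : bounded_measurable f -> bounded_measurable g ->
  bounded_measurable (fun x => f x * g x).
Proof.
move=> [mf [M fM]] [mg [N gN]]; split; first exact: measurable_funM.
by exists (M * N) => x; rewrite normrM ler_pM.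
Qed.

Lemma bounded_measurableZ c f : bounded_measurable f ->
  bounded_measurable (fun x => c * f x).
Proof. by move=> bf; apply: bounded_measurableM => //; exact: bounded_measurable_cst. Qed.

Lemma bounded_measurableB f g : bounded_measurable f -> bounded_measurable g ->
  bounded_measurable (fun x => f x - g x).
Proof.
move=> bf bg; have := bounded_measurableD bf (bounded_measurableZ (-1) bg).
by under eq_fun do rewrite mulN1r.
Qed.

Lemma bounded_measurable_sum (I : Type) (s : seq I) (F : I -> T -> R) :
  (forall i, bounded_measurable (F i)) ->
  bounded_measurable (fun x => \sum_(i <- s) F i x).
Proof.
move=> bF; elim: s => [|i s ih].
  by under eq_fun do rewrite big_nil; exact: bounded_measurable_cst.
by under eq_fun do rewrite big_cons; exact: bounded_measurableD.
Qed.

Lemma bounded_measurable_norm f : bounded_measurable f ->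
  bounded_measurable (fun x => `|f x|).
Proof.
move=> [mf [M fM]]; split; first exact: measurableT_comp.
by exists M => x; rewrite normr_id.
Qed.

Lemma bounded_measurable_indic (B : set T) : measurable B ->
  bounded_measurable \1_B.
Proof.
move=> mB; split; first exact: measurable_indic.
by exists 1 => x; rewrite ger0_norm// indicE; case: (_ \in _).
Qed.

(** Finitely additive probabilities, seen through their integrals. One calculus thus serves
    integrals, the operators f -> K^j f (u), Cesaro averages and their ultrafilter limits, for which
    countable additivity is not known beforehand. *)
Definition mean L := [/\
  forall f g, bounded_measurable f -> bounded_measurable g ->
    L (fun x => f x + g x) = L f + L g,
  forall c f, bounded_measurable f -> L (fun x => c * f x) = c * L f,
  forall f, bounded_measurable f -> (forall x, 0 <= f x) -> 0 <= L f &
  L (fun=> 1) = 1].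

Section mean_theory.
Context L (LM : mean L).

Lemma meanD f g : bounded_measurable f -> bounded_measurable g ->
  L (fun x => f x + g x) = L f + L g.
Proof. by case: LM => + _ _ _; exact. Qed.

Lemma meanZ c f : bounded_measurable f -> L (fun x => c * f x) = c * L f.
Proof. by case: LM => _ + _ _; exact. Qed.

Lemma mean_cst c : L (fun=> c) = c.
Proof.
rewrite (_ : (fun=> c) = (fun x : T => c * (fun=> 1) x)); last first.
  by apply/funext => x; rewrite mulr1.
rewrite meanZ; last exact: bounded_measurable_cst.
by case: LM => _ _ _ ->; rewrite mulr1.
Qed.

Lemma meanB f g : bounded_measurable f -> bounded_measurable g ->
  L (fun x => f x - g x) = L f - L g.
Proof.
move=> bf bg; rewrite -mulN1r -meanZ// -meanD//; last exact: bounded_measurableZ.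
by congr L; apply/funext => x; rewrite mulN1r.
Qed.

Lemma mean_le f g : bounded_measurable f -> bounded_measurable g ->
  (forall x, f x <= g x) -> L f <= L g.
Proof.
move=> bf bg fg; rewrite -subr_ge0 -meanB//; case: LM => _ _ + _; apply.
  exact: bounded_measurableB.
by move=> x; rewrite subr_ge0.
Qed.

Lemma mean_norm_le f M : bounded_measurable f -> (forall x, `|f x| <= M) ->
  `|L f| <= M.
Proof.
move=> bf fM; rewrite ler_norml -{1}(mean_cst (- M)) -{2}(mean_cst M).
by apply/andP; split; apply: mean_le => //; try exact: bounded_measurable_cst;
  move=> x; have := fM x; rewrite ler_norml => /andP[].
Qed.

Lemma mean_sum (I : Type) (s : seq I) (F : I -> T -> R) :
  (forall i, bounded_measurable (F i)) ->
  L (fun x => \sum_(i <- s) F i x) = \sum_(i <- s) L (F i).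
Proof.
move=> bF; elim: s => [|i s ih].
  by under eq_fun do rewrite big_nil; rewrite big_nil mean_cst.
under eq_fun do rewrite big_cons.
by rewrite big_cons meanD ?ih//; exact: bounded_measurable_sum.
Qed.

End mean_theory.

(** After an affine change, f takes values in [0, n); there, the indicators of the sets where f is
    at least j + 1 add up to its integer part. *)
Lemma simple_approximation f (eps : R) : bounded_measurable f -> 0 < eps ->
  exists (a : R) (n : nat) (B : nat -> set T), (forall j, measurable (B j)) /\
    forall x, `|f x - (a + eps * \sum_(j <- iota 0 n) \1_(B j) x)| <= eps.
Proof.
move=> [mf [M fM]] eps0.
have [n nM] : exists n : nat, 2 * M / eps < n%:R.
  exists (Num.truncn (2 * M / eps)).+1; exact: truncnS_gt.
pose g x := (f x + M) / eps.
have fg x : f x = - M + eps * g x by rewrite /g mulrC divfK ?gt_eqF// addrC addrK.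
have g0 x : 0 <= g x.
  rewrite divr_ge0 ?(ltW eps0)//; have := fM x; rewrite ler_norml => /andP[]; lra.
have gn x : g x < n%:R.
  apply: le_lt_trans nM; rewrite ler_pM2r ?invr_gt0//.
  by have := fM x; rewrite ler_norml => /andP[]; lra.
exists (- M), n, (fun j => [set x | j.+1%:R <= g x]); split => [j|x].
  rewrite -[X in measurable X]setTI; apply: measurable_fun_le => //.
  by apply: measurable_funM => //; exact: measurable_funD.
rewrite fg opprD addrACA subrr add0r -mulrBr normrM (gtr0_norm eps0).
rewrite -[leRHS]mulr1 ler_pM2l//.
(* The first k indicators are all 1 as long as k <= [g x]; once k exceeds [g x], the sum stays at
   the integer part. *)
have h k : (k%:R <= g x -> \sum_(j <- iota 0 k) \1_[set x | j.+1%:R <= g x] x = k%:R :> R)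
    /\ (g x < k%:R -> `|g x - \sum_(j <- iota 0 k) \1_[set x | j.+1%:R <= g x] x| <= 1).
  elim: k => [|k [ih1 ih2]].
    by rewrite /= big_nil; split=> //; rewrite ltNge g0.
  rewrite -addn1 iotaD big_cat/= big_seq1 add0n addn1; split => [kg|gk].
    rewrite ih1; last by apply: le_trans kg; rewrite ler_nat.
    by rewrite indicE mem_set// -natrD addn1.
  rewrite (_ : \1_[set x | k.+1%:R <= g x] x = 0) ?addr0; last first.
    by rewrite indicE memNset//=; apply/negP; rewrite -ltNge.
  have [kg|/ih2//] := leP k%:R (g x).
  rewrite ih1// ger0_norm ?subr_ge0//.
  by move: gk; rewrite -natr1; lra.
by have [_] := h n; apply.
Qed.

(* Bounded measurable functions are uniform limits of simple functions. *)
Lemma mean_eq L L' : mean L -> mean L' ->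
  (forall B, measurable B -> L \1_B = L' \1_B) ->
  forall f, bounded_measurable f -> L f = L' f.
Proof.
move=> LM LM' LL f bf; apply/eqP; rewrite -subr_eq0 -normr_le0.
apply/ler_addgt0Pl => e e0; rewrite addr0.
have e20 : 0 < e / 2 by rewrite divr_gt0.
have [a [n [B [mB fB]]]] := simple_approximation bf e20.
pose h x := a + e / 2 * \sum_(j <- iota 0 n) \1_(B j) x.
have bB j : bounded_measurable (\1_(B j) : T -> R) by exact: bounded_measurable_indic.
have bS : bounded_measurable (fun x => \sum_(j <- iota 0 n) (\1_(B j) x : R)).
  exact: bounded_measurable_sum.
have bh : bounded_measurable h.
  apply: bounded_measurableD; first exact: bounded_measurable_cst.
  exact: bounded_measurableZ.
have Lh : L h = L' h.
  rewrite /h !meanD//; try exact: bounded_measurable_cst;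
    try exact: bounded_measurableZ.
  rewrite !meanZ// !mean_cst// !mean_sum//; congr (_ + _ * _).
  by apply: eq_bigr => j _; exact: LL.
have -> : L f - L' f = (L f - L h) - (L' f - L' h) by rewrite Lh; ring.
apply: le_trans (ler_normB _ _) _; rewrite (splitr e); apply: lerD;
by rewrite -meanB//; apply: mean_norm_le => //; exact: bounded_measurableB.
Qed.

Section probability_integrals.
Context (mu : {measure set T -> \bar R}) (mu1 : mu setT = 1%E).

Lemma bounded_measurable_integrable f : bounded_measurable f ->
  mu.-integrable setT (EFin \o f).
Proof.
move=> [mf [M fM]]; apply: measurable_bounded_integrable => //.
  by rewrite mu1 ltry.
exists M; split; first exact: num_real.
by move=> N MN x _; apply: le_trans (fM x) (ltW MN).
Qed.

Lemma mean_Rintegral : mean (fun f => \int[mu]_x f x).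
Proof.
split.
- by move=> f g bf bg; rewrite RintegralD//; exact: bounded_measurable_integrable.
- by move=> c f bf; rewrite RintegralZl//; exact: bounded_measurable_integrable.
- by move=> f bf f0; apply: Rintegral_ge0.
- by rewrite Rintegral_cst// mu1 mul1r.
Qed.

Lemma Rintegral_bounded_cvg0 (h : nat -> T -> R) (M : R) :
  (forall n, measurable_fun setT (h n)) -> (forall n x, `|h n x| <= M) ->
  (forall x, h n x @[n --> \oo] --> 0) -> \int[mu]_x h n x @[n --> \oo] --> 0.
Proof.
move=> mh hM h0.
have [] := @dominated_convergence _ _ _ mu setT measurableT
  (fun n => EFin \o h n) (cst 0%E) (cst M%:E).
- by move=> n; exact/measurable_EFinP.
- exact: measurable_cst.
- by apply: aeW => x _; apply/cvg_EFin; [near=> n|exact: h0].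
- apply: (@bounded_measurable_integrable (fun=> M)); exact: bounded_measurable_cst.
- by apply: aeW => x n _; rewrite lee_fin.
move=> _ _; rewrite integral0 => h1.
exact: (fine_cvg h1).
Unshelve. all: by end_near. Qed.

End probability_integrals.

Lemma mean_limit (G : set_system nat) {GF : ProperFilter G}
    (L_ : nat -> (T -> R) -> R) L : (forall n, mean (L_ n)) ->
  (forall f, bounded_measurable f -> L_ n f @[n --> G] --> L f) -> mean L.
Proof.
move=> LM LL; split.
- move=> f g bf bg; apply: (@cvg_unique _ _ (L_ n (fun x => f x + g x) @[n --> G])).
    exact: @Rhausdorff.
    by apply: LL; exact: bounded_measurableD.
  rewrite (_ : (fun n => _) = (fun n => L_ n f + L_ n g)); last first.
    by apply/funext => n; rewrite (meanD (LM n)).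
  by apply: cvgD; exact: LL.
- move=> c f bf; apply: (@cvg_unique _ _ (L_ n (fun x => c * f x) @[n --> G])).
    exact: @Rhausdorff.
    by apply: LL; exact: bounded_measurableZ.
  rewrite (_ : (fun n => _) = (fun n => c * L_ n f)); last first.
    by apply/funext => n; rewrite (meanZ (LM n)).
  by apply: cvgMr; exact: LL.
- move=> f bf f0; apply: (cvgr_to_ge (LL f bf)).
  by apply: filterE => n; case: (LM n) => _ _ + _; exact.
- apply: (@cvg_unique _ _ (L_ n (fun=> 1) @[n --> G])).
    exact: @Rhausdorff.
    by apply: LL; exact: bounded_measurable_cst.
  rewrite (_ : (fun n => _) = (fun=> 1)); first exact: cvg_cst.
  by apply/funext => n; rewrite (mean_cst (LM n)).
Qed.
End means.

(** * Total variation and Borel sets *)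

Section borel_approximation.
Context (R : realType) (d : measure_display) (S : borelMetricType d R).
Implicit Types (f g : S -> R) (B U : set S).

Lemma continuous_measurable f : continuous f -> measurable_fun setT f.
Proof.
move=> cf; apply: (measurability _ (RGenOInfty.measurableE R)).
move=> /= _ [_ [a ->]] <-; rewrite setTI measurable_borel.
apply: sub_sigma_algebra; apply: open_comp => [x _|]; [exact: cf|].
by rewrite set_itvE; exact: open_gt.
Qed.

Lemma continuous_bounded_measurable f : compact [set: S] -> continuous f ->
  bounded_measurable f.
Proof.
move=> cS cf; split; first exact: continuous_measurable.
have /compact_bounded[M [_ fM]] : compact (f @` setT).
  by apply: continuous_compact => //; exact: continuous_subspaceT.
exists (M + 1) => x; apply: (fM (M + 1)); first by rewrite ltrDl.
by exists x.
Qed.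

(* The functions [min 1 (n dist(x, ~` U))] increase to the indicator of [U]. *)
Lemma open_indic_limit U : open U -> exists f : nat -> S -> R, [/\
  forall n, continuous (f n), forall n x, 0 <= f n x <= 1 &
  forall x, f n x @[n --> \oo] --> (\1_U x : R)].
Proof.
move=> oU; have [UT|/set0P U0] := eqVneq (~` U) set0.
  (* The distance to an empty complement is meaningless, so the whole space is treated apart. *)
  exists (fun _ _ => 1); split => [n x|n x|x].
  - exact: cvg_cst.
  - by rewrite lexx ler01.
  - rewrite indicE mem_set; first exact: cvg_cst.
    by apply: contrapT => nUx; have : (~` U) x by []; rewrite UT.
pose D x := [set mdist x a | a in ~` U] : set R.
have D0 x : D x !=set0 by case: U0 => a Ua; exists (mdist x a), a.
have Dlb x : lbound (D x) 0 by move=> _ [a _ <-]; exact: mdist_ge0.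
have hD x : has_lbound (D x) by exists 0.
pose h x := inf (D x).
have h0 x : 0 <= h x by exact: lb_le_inf.
(* [h], the distance to the complement, is 1-Lipschitz, hence continuous. *)
have hh x y : h x <= mdist x y + h y.
  rewrite -lerBlDl; apply: lb_le_inf => // _ [a Ua <-].
  rewrite lerBlDl; apply: le_trans (metric_triangle x y a).
  by apply: ge_inf => //; exists a.
have ch : continuous h.
  move=> x; apply/cvgrPdist_lt => e e0.
  have : nbhs x (ball x e) by exact: nbhsx_ballx.
  apply: filterS => y; rewrite ballEmdist/= => xy.
  rewrite ltr_norml; apply/andP; split.
    by rewrite ltrNl opprB ltrBlDr; have := hh y x; rewrite metric_sym; lra.
  by have := hh x y; lra.
exists (fun n x => Num.min 1 (n%:R * h x)); split => [n x|n x|x].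
- apply: (@continuous_min _ _ (cst 1) (fun x => n%:R * h x)); first exact: cvg_cst.
  by apply: cvgMr; exact: ch.
- rewrite le_min ler01 mulr_ge0//=.
  by rewrite ge_min lexx.
- have [Ux|nUx] := pselect (U x); last first.
    rewrite indicE memNset//.
    suff hx : h x = 0.
      rewrite (_ : (fun n => _) = cst 0); first exact: cvg_cst.
      by apply/funext => n; rewrite hx mulr0 minEle ler10.
    apply/eqP; rewrite eq_le h0 andbT -(mdistxx x).
    by apply: ge_inf => //; exists x.
  rewrite indicE mem_set//.
  have : nbhs x U by exact: open_nbhs_nbhs.
  rewrite -nbhs_ballE => -[e /= e0 xeU].
  have eh : e <= h x.
    apply: lb_le_inf => // _ [a Ua <-]; rewrite leNgt; apply/negP => xa.
    by apply: Ua; apply: xeU; rewrite ballEmdist.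
  (* A ball of radius e around x lies in U, so the minimum equals 1 as soon as n >= 1/e. *)
  apply: cvg_near_cst; near=> n.
  rewrite minEle ifT//.
  have n1 : e^-1 <= n%:R by near: n; exact: nbhs_infty_ger.
  have : e^-1 * e <= n%:R * h x by apply: ler_pM; rewrite ?invr_ge0 ?(ltW e0).
  by rewrite mulVf// gt_eqF.
Unshelve. all: by end_near. Qed.

End borel_approximation.

Section total_variation_of_sets.
Context (R : realType) (d : measure_display) (S : borelMetricType d R).
Hypothesis compactS : compact [set: S].
Context (mu nu : {measure set S -> \bar R}).
Hypotheses (mu1 : mu setT = 1%E) (nu1 : nu setT = 1%E).

Let L1 (f : S -> R) (B : set S) (e : R) :=
  \int[mu]_x `|f x - \1_B x| <= e /\ \int[nu]_x `|f x - \1_B x| <= e.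

Let bm_dist (f : S -> R) (B : set S) : continuous f -> measurable B ->
  bounded_measurable (fun x => `|f x - \1_B x|).
Proof.
move=> cf mB; apply: bounded_measurable_norm; apply: bounded_measurableB.
  exact: continuous_bounded_measurable.
exact: bounded_measurable_indic.
Qed.

Let small_eventually (h : nat -> S -> R) (M e : R) : 0 < e ->
  (forall n, measurable_fun setT (h n)) -> (forall n x, `|h n x| <= M) ->
  (forall x, h n x @[n --> \oo] --> 0) ->
  exists n, \int[mu]_x h n x <= e /\ \int[nu]_x h n x <= e.
Proof.
move=> e0 mh hM h0.
have Hm := Rintegral_bounded_cvg0 mu1 mh hM h0.
have Hn := Rintegral_bounded_cvg0 nu1 mh hM h0.
have : \forall n \near \oo, \int[mu]_x h n x <= e /\ \int[nu]_x h n x <= e.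
  near=> n; split; near: n.
    exact: (cvgr_le _ Hm).
  exact: (cvgr_le _ Hn).
by move=> [n _ /(_ n (leqnn n))]; exists n.
Unshelve. all: by end_near. Qed.

(** A single f must work for both measures, since the two integrals of the same f are compared
    later. The sets with this property contain the open ones, a pi-system, and are stable under
    proper differences and increasing unions, so Dynkin's theorem gives all Borel sets. *)
Lemma indic_continuous_approximation (B : set S) (e : R) : measurable B ->
  0 < e -> exists2 f : S -> R, continuous f & L1 f B e.
Proof.
move=> mB; move: e.
pose H := [set A : set S | measurable A /\ forall e, 0 < e ->
  exists2 f : S -> R, continuous f & L1 f A e].
suff : @measurable d S `<=` H by move=> /(_ B mB)[].
rewrite measurable_borel; apply: lambda_system_subset => //.
- by move=> A C; exact: openI.
- split=> //.
  + split=> // e e0; exists (cst 1); first exact: cst_continuous.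
    by split; under eq_Rintegral do rewrite indicT subrr normr0;
      rewrite Rintegral_cst// mul0r ltW.
  + move=> A C CA [mA hA] [mC hC]; split; first exact: measurableD.
    move=> e e0; have e20 : 0 < e / 2 by rewrite divr_gt0.
    have [f cf [fA fA']] := hA _ e20; have [g cg [gC gC']] := hC _ e20.
    exists (fun x => f x - g x); first by move=> x; apply: cvgB; [exact: cf|exact: cg].
    have fg x : `|f x - g x - \1_(A `\` C) x| <= `|f x - \1_A x| + `|g x - \1_C x|.
      have -> : (\1_(A `\` C) x : R) = \1_A x - \1_C x.
        rewrite !indicE in_setD; have [xC|xC] := boolP (x \in C).
          by rewrite andbF (mem_set (CA _ (set_mem xC))) subrr.
        by rewrite andbT subr0.
      have -> : f x - g x - (\1_A x - \1_C x) = (f x - \1_A x) - (g x - \1_C x).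
        by ring.
      exact: ler_normB.
    have key (m : {measure set S -> \bar R}) : m setT = 1%E ->
        \int[m]_x `|f x - \1_A x| <= e / 2 -> \int[m]_x `|g x - \1_C x| <= e / 2 ->
        \int[m]_x `|f x - g x - \1_(A `\` C) x| <= e.
      move=> m1 hf hg; rewrite (splitr e); apply: le_trans (lerD hf hg).
      have LM := mean_Rintegral m1.
      have bf := bm_dist cf mA; have bg := bm_dist cg mC.
      rewrite -(meanD LM bf bg); apply: (mean_le LM) => //.
        apply: (@bm_dist (fun x => f x - g x)); last exact: measurableD.
        by move=> x; apply: cvgB; [exact: cf|exact: cg].
      exact: bounded_measurableD.
    by split; exact: key.
  + move=> F ndF HF; have mF n : measurable (F n) by have [] := HF n.
    have mUF : measurable (\bigcup_i F i) by exact: bigcup_measurable.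
    split=> // e e0; have e20 : 0 < e / 2 by rewrite divr_gt0.
    pose h n x : R := \1_(\bigcup_i F i) x - \1_(F n) x.
    have hE n x : h n x = \1_(\bigcup_i F i `\` F n) x.
      rewrite /h !indicE in_setD; have [xC|xC] := boolP (x \in F n).
        rewrite andbF mem_set ?subrr//; exists n => //; exact: set_mem.
      by rewrite andbT subr0.
    have bh n : bounded_measurable (h n).
      by apply: bounded_measurableB; exact: bounded_measurable_indic.
    have [n [hn hn']] : exists n, \int[mu]_x h n x <= e / 2 /\ \int[nu]_x h n x <= e / 2.
      apply: (@small_eventually h 1) => //.
      - by move=> n; have [] := bh n.
      - by move=> n x; rewrite hE ger0_norm// indicE; case: (_ \in _).
      move=> x; apply: cvg_near_cst; have [[k _ Fkx]|nF] := pselect ((\bigcup_i F i) x).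
        near=> n; rewrite hE indicE memNset// => -[_]; apply.
        have kn : (k <= n)%N by near: n; exact: nbhs_infty_ge.
        by have /subsetPset := ndF _ _ kn; exact.
      by near=> n; rewrite hE indicE memNset// => -[].
    have [_ /(_ _ e20)[f cf [fF fF']]] := HF n.
    exists f => //.
    have key (m : {measure set S -> \bar R}) : m setT = 1%E ->
        \int[m]_x `|f x - \1_(F n) x| <= e / 2 -> \int[m]_x h n x <= e / 2 ->
        \int[m]_x `|f x - \1_(\bigcup_i F i) x| <= e.
      move=> m1 hf hg; rewrite (splitr e); apply: le_trans (lerD hf hg).
      have LM := mean_Rintegral m1.
      have bf := bm_dist cf (mF n).
      rewrite -(meanD LM bf (bh n)); apply: (mean_le LM) => //.
      - exact: bm_dist.
      - exact: bounded_measurableD.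
      - move=> x; rewrite -[h n x]ger0_norm; last by rewrite hE.
        apply: le_trans (ler_normB _ _); rewrite le_eqVlt /h; apply/orP; left.
        by apply/eqP; congr (`|_|); ring.
    by split; exact: key.
- move=> U oU; have mU : measurable U.
    by rewrite measurable_borel; exact: sub_sigma_algebra.
  split=> // e e0; have [f [cf f01 fU]] := open_indic_limit oU.
  have bh n := bm_dist (cf n) mU.
  have [n [fn fn']] : exists n, \int[mu]_x `|f n x - \1_U x| <= e /\
      \int[nu]_x `|f n x - \1_U x| <= e.
    apply: (@small_eventually (fun n x => `|f n x - \1_U x|) 1) => //.
    - by move=> n; have [] := bh n.
    - move=> n x; rewrite normr_id indicE; have /andP[f0 f1] := f01 n x.
      by case: (_ \in _); rewrite /= ?mulr1n ?mulr0n ler_norml; lra.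
    - move=> x; apply/norm_cvg0P; rewrite -(subrr (\1_U x)).
      by apply: cvgB; [exact: fU|exact: cvg_cst].
  by exists (f n).
Unshelve. all: by end_near. Qed.

(** Transfers a bound tested on continuous functions to all Borel sets. *)
Lemma total_variation_set (c : R) :
  (forall f : S -> R, continuous f -> (forall x, `|f x| <= 1) ->
    `|\int[mu]_x f x - \int[nu]_x f x| <= c) ->
  forall B, measurable B -> `|fine (mu B) - fine (nu B)| <= c.
Proof.
move=> H B mB; apply/ler_addgt0Pr => e e0.
have e20 : 0 < e / 2 by rewrite divr_gt0.
have [f cf [fm fn]] := indic_continuous_approximation mB e20.
(* Truncation to [0, 1] makes the approximation an admissible test function and does not increase
   its distance to an indicator. *)
pose g x := Num.max 0 (Num.min 1 (f x)).
have cg : continuous g.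
  move=> x; apply: (@continuous_max _ _ (cst 0) (fun x => Num.min 1 (f x))).
    exact: cvg_cst.
  by apply: (@continuous_min _ _ (cst 1) f); [exact: cvg_cst|exact: cf].
have g01 x : 0 <= g x <= 1.
  by rewrite /g le_max lexx ge_max ler01 ge_min lexx.
have gf x : `|g x - \1_B x| <= `|f x - \1_B x|.
  have := ler_norm (f x - \1_B x); have := ler_norm (- (f x - \1_B x)).
  rewrite normrN ler_norml; set N := `|_|; rewrite /g indicE maxEle minEle.
  case: (_ \in _); rewrite /= ?mulr1n ?mulr0n; case: ifPn; case: ifPn;
    rewrite -?ltNge; lra.
have key (m : {measure set S -> \bar R}) : m setT = 1%E ->
    \int[m]_x `|f x - \1_B x| <= e / 2 -> `|fine (m B) - \int[m]_x g x| <= e / 2.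
  move=> m1; apply: le_trans.
  have LM := mean_Rintegral m1.
  have bB := bounded_measurable_indic R mB.
  have bg := continuous_bounded_measurable compactS cg.
  have -> : fine (m B) = \int[m]_x \1_B x.
    by rewrite /Rintegral integral_indic// setIT.
  rewrite -(meanB LM bB bg).
  apply: (@le_trans _ _ (\int[m]_x `|g x - \1_B x|)).
    under [leRHS]eq_Rintegral do rewrite distrC.
    apply: le_normr_Rintegral => //; apply: bounded_measurable_integrable => //.
    exact: bounded_measurableB.
  by apply: (mean_le LM) => //; exact: bm_dist.
have g1 x : `|g x| <= 1 by have := g01 x; rewrite ler_norml; lra.
have := H g cg g1; have := key mu mu1 fm; have := key nu nu1 fn.
rewrite !ler_norml; lra.
Qed.

End total_variation_of_sets.

(** * Kernel operators and the Poisson equation *)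

Lemma cvge0_lt (R : realType) (T : Type) (F : set_system T) (FF : Filter F)
    (X : T -> \bar R) (e : R) :
  X x @[x --> F] --> 0%E -> 0 < e -> \forall x \near F, (X x < e%:E)%E.
Proof.
move=> h e0; apply: (h [set y | (y < e%:E)%E]); apply: open_nbhs_nbhs; split.
  exact: open_ereal_lt_ereal.
by rewrite /= lte_fin.
Qed.

Section kernel_operator.
Context (R : realType) (d d' : measure_display) (X : measurableType d)
  (Y : measurableType d') (K : R.-pker X ~> Y).

(** Real-valued, so that ring reasoning applies; for unbounded [f] the value is meaningful only once
    integrability is established. *)
Definition kop (f : Y -> R) (x : X) : R := \int[K x]_y f y.

Lemma mean_kop x : mean (kop ^~ x).
Proof. by apply: mean_Rintegral; exact: prob_kernel. Qed.

Lemma EFin_kop f x : bounded_measurable f ->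
  (kop f x)%:E = (\int[K x]_y (f y)%:E)%E.
Proof.
move=> bf; rewrite /kop /Rintegral fineK//; apply: integrable_fin_num => //.
by apply: bounded_measurable_integrable => //; exact: prob_kernel.
Qed.

Lemma kop_indic B x : measurable B -> (kop \1_B x)%:E = K x B.
Proof.
move=> mB; rewrite EFin_kop; last exact: bounded_measurable_indic.
by rewrite integral_indic// setIT.
Qed.

Lemma kop_bounded_measurable f : bounded_measurable f -> bounded_measurable (kop f).
Proof.
move=> bf; have [mf [M fM]] := bf; split; last first.
  by exists M => x; exact: (mean_norm_le (mean_kop x)).
(* Measurability of kernel integrals is stated for nonnegative functions; the shift by [M] makes f
   nonnegative. *)
have bfM : bounded_measurable (fun y => f y + M).
  by apply: bounded_measurableD => //; exact: bounded_measurable_cst.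
rewrite (_ : kop f = (fun x => fine (\int[K x]_y (f y + M)%:E)%E - M)); last first.
  apply/funext => x; rewrite -EFin_kop//=.
  rewrite (meanD (mean_kop x))//; last exact: bounded_measurable_cst.
  by rewrite (mean_cst (mean_kop x)) addrK.
apply: measurable_funB => //; apply: measurableT_comp => //.
apply: measurable_fun_integral_kernel.
- by move=> U mU; exact: measurable_kernel.
- by move=> y; rewrite lee_fin; have := fM y; rewrite ler_norml; lra.
- by apply/measurable_EFinP; case: bfM.
Qed.

End kernel_operator.

(** * Strong Feller property of a kernel continuous in total variation *)

Section strong_feller.
Context (R : realType) (d : measure_display) (S : borelMetricType d R).
Hypothesis compactS : compact [set: S].
Context (K : R.-pker S ~> S) (K_continuous : tv_continuous K).

Lemma tv_norm_sub_ge (mu nu : set S -> \bar R) (f : S -> R) :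
  continuous f -> (forall x, `|f x| <= 1) ->
  (\int[mu]_x (f x)%:E - \int[nu]_x (f x)%:E <= tv_norm_sub mu nu)%E.
Proof. by move=> cf f1; apply: ereal_sup_ubound; exists f. Qed.

Lemma kop_equicontinuous u e : 0 < e -> \forall v \near u,
  forall f : S -> R, continuous f -> (forall x, `|f x| <= 1) ->
    `|kop K f v - kop K f u| <= e.
Proof.
(* The factor 1/2 matches the one in [dTV]. *)
move=> e0; have e20 : 0 < 2^-1 * e by rewrite mulr_gt0.
have := cvge0_lt (nbhs_filter u) (K_continuous u) e20; apply: filterS => v uv.
have key f : continuous f -> (forall x, `|f x| <= 1) ->
    kop K f v - kop K f u <= e.
  move=> cf f1; have bf := continuous_bounded_measurable compactS cf.
  rewrite -lee_fin EFinB !EFin_kop//; apply: le_trans (tv_norm_sub_ge _ _ cf f1) _.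
  by have /ltW := uv; rewrite /dTV EFinM lee_pmul2l// lte_fin.
move=> f cf f1; rewrite ler_norml key// andbT.
have bf := continuous_bounded_measurable compactS cf.
have := key (fun x => -1 * f x).
rewrite !(meanZ (mean_kop K _))// => H.
have : -1 * kop K f v - -1 * kop K f u <= e; last lra.
by apply: H => x; [apply: cvgMr; exact: cf|rewrite mulN1r normrN].
Qed.

Lemma kop_continuous f : continuous f -> continuous (kop K f).
Proof.
move=> cf u; have bf := continuous_bounded_measurable compactS cf.
have [_ [M fM]] := bf.
have M1 : 0 < `|M| + 1 by rewrite ltr_wpDl.
apply/cvgrPdist_le => e e0.
have eM : 0 < e / (`|M| + 1) by rewrite divr_gt0.
have := kop_equicontinuous u eM; apply: filterS => v uv.
(* Rescaling puts f into the unit ball of test functions; the 1 avoids a division by zero. *)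
have := uv (fun x => (`|M| + 1)^-1 * f x).
rewrite !(meanZ (mean_kop K _))// -mulrBr normrM gtr0_norm ?invr_gt0//.
rewrite mulrC ler_pM2r ?invr_gt0// distrC; apply.
- by move=> x; apply: cvgMr; exact: cf.
- move=> x; rewrite normrM gtr0_norm ?invr_gt0// mulrC ler_pdivrMr// mul1r.
  by rewrite (le_trans (fM x))// (le_trans (ler_norm M))// lerDl.
Qed.

(** The neighbourhood of u does not depend on B: this uniformity is what makes the Dini argument
    below possible. *)
Lemma kernel_equicontinuous u e : 0 < e -> \forall v \near u,
  forall B, measurable B -> `|kop K \1_B v - kop K \1_B u| <= e.
Proof.
move=> /(kop_equicontinuous u); apply: filterS => v uv B mB.
have E w : kop K \1_B w = fine (K w B) by rewrite -kop_indic.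
rewrite !E; apply: total_variation_set => //; exact: prob_kernel.
Qed.

(* Dini's theorem for the continuous functions [K _ (B n)]. *)
Lemma kernel_uniformly_continuous_at_set0 (B : (set S)^nat) (e : R) :
  (forall n, measurable (B n)) -> nonincreasing_seq B -> \bigcap_n B n = set0 ->
  0 < e -> \forall n \near \oo, forall u, kop K \1_(B n) u <= e.
Proof.
move=> mB nB B0 e0.
have e20 : 0 < e / 2 by rewrite divr_gt0.
have /compact_near_coveringP cov := compactS.
suff : \forall n \near \oo, [set: S] `<=` (fun u => kop K \1_(B n) u <= e).
  by apply: filterS => n H u; exact: H.
(* At u itself, dominated convergence makes K u (B n) small; equicontinuity carries this to a
   neighbourhood of u independent of n, and compactness makes finitely many such neighbourhoods
   enough. *)
apply: cov => u _.
have Bu : \forall n \near \oo, kop K \1_(B n) u <= e / 2.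
  have h : (kop K \1_(B n) u) @[n --> \oo] --> 0.
    apply: (@Rintegral_bounded_cvg0 _ _ _ _ (prob_kernel u) (fun n => \1_(B n)) 1).
    - by move=> n; exact: measurable_indic.
    - by move=> n x; rewrite ger0_norm// indicE; case: (_ \in _).
    move=> x; apply: cvg_near_cst.
    have [k nBk] : exists k, ~ B k x.
      apply/existsNP => Bx; have : (\bigcap_n B n) x by move=> k _; exact: Bx.
      by rewrite B0.
    near=> n; rewrite indicE memNset// => Bnx; apply: nBk.
    have kn : (k <= n)%N by near: n; exact: nbhs_infty_ge.
    by have /subsetPset := nB _ _ kn; exact.
  exact: (cvgr_le _ h).
near=> v n => /=.
have H1 : kop K \1_(B n) u <= e / 2 by near: n.
have H2 : `|kop K \1_(B n) v - kop K \1_(B n) u| <= e / 2.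
  have : forall B, measurable B -> `|kop K \1_B v - kop K \1_B u| <= e / 2.
    by near: v; exact: kernel_equicontinuous.
  exact.
by move: H2; rewrite ler_norml; lra.
Unshelve. all: by end_near. Qed.

End strong_feller.

Lemma continuous_sum (R : realType) (T : topologicalType) (I : Type) (s : seq I)
    (F : I -> T -> R) : (forall i, continuous (F i)) ->
  continuous (fun x => \sum_(i <- s) F i x).
Proof.
move=> cF x; elim: s => [|i s ih].
  rewrite (_ : (fun y => _) = cst 0); first exact: cvg_cst.
  by apply/funext => y; rewrite big_nil.
rewrite (_ : (fun y => _) = (fun y => F i y + \sum_(i <- s) F i y)); last first.
  by apply/funext => y; rewrite big_cons.
by apply: continuousD => //; exact: cF.
Qed.

(** * Uniform convergence of Cesaro averages and the Poisson equation *)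

Section uniform_ergodicity.
Context (R : realType) (d : measure_display) (S : borelMetricType d R).
Hypothesis compactS : compact [set: S].
Context (K : R.-pker S ~> S) (K_continuous : tv_continuous K).
Context (pi : probability S R) (pi_invariant : unique_invariant_probability K pi).

Definition cesaro (n : nat) (f : S -> R) (u : S) : R :=
  n.+1%:R^-1 * \sum_(j < n.+1) iter j (kop K) f u.

Lemma iter_kop_bounded_measurable j f : bounded_measurable f ->
  bounded_measurable (iter j (kop K) f).
Proof. by move=> bf; elim: j => //= j; exact: kop_bounded_measurable. Qed.

Lemma mean_iter_kop j u : mean (fun f => iter j (kop K) f u).
Proof.
elim: j u => [|j ih] u /=; first by split=> //=; move=> f _; exact.
have Ku := mean_kop K u.
split => [f g bf bg|c f bf|f bf f0|].
- rewrite (_ : iter j _ _ = fun v => iter j (kop K) f v + iter j (kop K) g v); last first.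
    by apply/funext => v; rewrite (meanD (ih v)).
  by rewrite (meanD Ku)//; exact: iter_kop_bounded_measurable.
- rewrite (_ : iter j _ _ = fun v => c * iter j (kop K) f v); last first.
    by apply/funext => v; rewrite (meanZ (ih v)).
  by rewrite (meanZ Ku)//; exact: iter_kop_bounded_measurable.
- case: Ku => _ _ + _; apply; first exact: iter_kop_bounded_measurable.
  by move=> v; case: (ih v) => _ _ + _; exact.
- rewrite (_ : iter j _ _ = fun=> 1) ?(mean_cst Ku)//.
  by apply/funext => v; rewrite (mean_cst (ih v)).
Qed.

Lemma mean_cesaro n u : mean (fun f => cesaro n f u).
Proof.
have M j := mean_iter_kop j u; split => [f g bf bg|c f bf|f bf f0|].
- rewrite /cesaro -mulrDr -big_split/=; congr (_ * _).
  by apply: eq_bigr => j _; rewrite (meanD (M j)).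
- rewrite /cesaro mulrCA; congr (_ * _); rewrite mulr_sumr.
  by apply: eq_bigr => j _; rewrite (meanZ (M j)).
- rewrite mulr_ge0 ?invr_ge0//; apply: sumr_ge0 => j _.
  by case: (M j) => _ _ + _; exact.
- rewrite /cesaro (eq_bigr (fun=> 1)); last by move=> j _; rewrite (mean_cst (M j)).
  by rewrite sumr_const card_ord mulVf.
Qed.

(** The sum telescopes. The right-hand side is O(1/n) uniformly in u, which makes every limit of the
    averages invariant under K. *)
Lemma cesaro_kop n f u :
  cesaro n (kop K f) u - cesaro n f u = n.+1%:R^-1 * (iter n.+1 (kop K) f u - f u).
Proof.
rewrite /cesaro -mulrBr; congr (_ * _).
rewrite [X in X - _](eq_bigr (fun j : 'I_n.+1 => iter j.+1 (kop K) f u)); last first.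
  by move=> j _; rewrite -iterSr.
elim: n.+1 => [|m ih]; first by rewrite !big_ord0 /= !subrr.
by rewrite !big_ord_recr /=; rewrite /= in ih; lra.
Qed.

Section limit_mean.
Context (G : set_system nat) {UG : UltraFilter G} (Goo : \oo `<=` G).
Context (u : nat -> S).

(** The starting point [u n] varies with n; identifying this limit for every such sequence is what
    yields uniformity in the starting point. *)
Let L (f : S -> R) : R := lim (cesaro n f (u n) @[n --> G]).

Let L_cvg f : bounded_measurable f -> cesaro n f (u n) @[n --> G] --> L f.
Proof.
move=> bf; have [_ [M fM]] := bf.
apply: (@bounded_ultra_cvg _ G UG _ M) => n.
exact: (mean_norm_le (mean_cesaro n (u n))).
Qed.

Let LM : mean L.
Proof. exact: (mean_limit (fun n => mean_cesaro n (u n)) L_cvg). Qed.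

Let L_kop f : bounded_measurable f -> L (kop K f) = L f.
Proof.
move=> bf; have [_ [M fM]] := bf; apply/eqP; rewrite -subr_eq0; apply/eqP.
have h : cesaro n (kop K f) (u n) - cesaro n f (u n) @[n --> G] --> L (kop K f) - L f.
  by apply: cvgB; apply: L_cvg => //; exact: kop_bounded_measurable.
apply: (cvg_unique _ h) => //.
(* [G] refines the filter at infinity, so ordinary convergence suffices. *)
suff : cesaro n (kop K f) (u n) - cesaro n f (u n) @[n --> \oo] --> 0.
  by move=> H; apply: cvg_trans H; exact: cvg_app.
apply/norm_cvg0P; apply: (@squeeze_cvgr _ _ _ _ (fun=> 0) (fun n => n.+1%:R^-1 * (2 * M))).
- near=> n; rewrite normr_ge0/= cesaro_kop normrM gtr0_norm ?invr_gt0//.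
  rewrite ler_pM2l ?invr_gt0// (le_trans (ler_normB _ _))// mulr_natl mulr2n lerD//.
  exact: (mean_norm_le (mean_iter_kop n.+1 (u n))).
- exact: cvg_cst.
- rewrite -[X in _ --> X](mul0r (2 * M)); apply: cvgMl.
  exact: cvg_harmonic.
Unshelve. all: by end_near. Qed.

(** By invariance L sees K 1_(B n) instead of 1_(B n), and the former tends to 0 uniformly, whereas
    the latter does so only pointwise. *)
Let L_indic_small (B : (set S)^nat) : (forall n, measurable (B n)) ->
  nonincreasing_seq B -> \bigcap_n B n = set0 -> L \1_(B n) @[n --> \oo] --> 0.
Proof.
move=> mB nB B0; apply/cvgrPdist_le => e e0; near=> n.
have bB := bounded_measurable_indic R (mB n).
have bKB := kop_bounded_measurable K bB.
rewrite sub0r normrN -L_kop//; apply: (mean_norm_le LM) => // v.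
have Kv := mean_kop K v.
rewrite ger0_norm; last by case: Kv => _ _ + _; apply.
move: v {Kv}; near: n.
exact: kernel_uniformly_continuous_at_set0.
Unshelve. all: by end_near. Qed.

(** On indicators the limit mean is a genuine probability, invariant under K; by uniqueness it is
    pi, whatever the ultrafilter and the starting points. *)
Lemma cesaro_ultra_cvg f : bounded_measurable f ->
  cesaro n f (u n) @[n --> G] --> \int[pi]_x f x.
Proof.
move=> bf; suff <- : L f = \int[pi]_x f x by exact: L_cvg.
(* [probability_of_content] requires nonnegativity on all sets, but L is known to be positive only
   on measurable ones; hence the absolute value. *)
have [nu nuE] : exists nu : probability S R, forall B, nu B = `|L \1_B|%:E.
  apply: probability_of_content => [B|||B mB nB B0].
  - exact: normr_ge0.
  - by rewrite indicT (mean_cst LM) normr1.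
  - move=> A B mA mB AB.
    have bA := bounded_measurable_indic R mA.
    have bB := bounded_measurable_indic R mB.
    rewrite (_ : \1_(A `|` B) = (fun x => \1_A x + \1_B x)); last first.
      apply/funext => x; rewrite !indicE in_setU.
      have [xA|xA] := boolP (x \in A); last by rewrite add0r.
      have [xB|xB] := boolP (x \in B); last by rewrite addr0.
      have : (A `&` B) x by split; exact: set_mem.
      by rewrite AB.
    rewrite (meanD LM)// !ger0_norm ?addr_ge0//; case: LM => _ _ + _; exact.
  - by apply/norm_cvg0P; exact: L_indic_small.
have LE B : measurable B -> L \1_B = \int[nu]_x \1_B x.
  move=> mB; have -> : \int[nu]_x \1_B x = fine (nu B).
    by rewrite /Rintegral integral_indic// setIT.
  rewrite nuE/= ger0_norm//.
  by case: LM => _ _ + _; apply => //; exact: bounded_measurable_indic.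
have nuM : mean (fun f => \int[nu]_x f x).
  by apply: mean_Rintegral; exact: probability_setT.
have Lnu := mean_eq LM nuM LE.
have [_ nu_pi] := pi_invariant.
have {}nu_pi : forall B, measurable B -> nu B = pi B.
  apply: nu_pi => B mB.
  have bB := bounded_measurable_indic R mB.
  have bKB := kop_bounded_measurable K bB.
  under eq_integral do rewrite -kop_indic//.
  rewrite nuE -[RHS]fineK; last first.
    apply: integrable_fin_num => //; apply: bounded_measurable_integrable => //.
    exact: probability_setT.
  rewrite -/(Rintegral _ _ _) -Lnu// L_kop// ger0_norm//.
  by case: LM => _ _ + _; apply.
rewrite Lnu//; apply: mean_eq bf => //.
  by apply: mean_Rintegral; exact: probability_setT.
by move=> B mB; rewrite /Rintegral !integral_indic// setIT; congr fine; exact: nu_pi.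
Qed.

End limit_mean.

(** If every n had a bad starting point, the averages from these points would still converge to
    pi(f) along an ultrafilter refining infinity, a contradiction. *)
Lemma uniform_ergodicity f (e : R) : bounded_measurable f -> 0 < e ->
  exists n, forall u, `|cesaro n f u - \int[pi]_x f x| <= e.
Proof.
move=> bf e0; apply: contrapT => /forallNP H.
have {}H n : exists u, e < `|cesaro n f u - \int[pi]_x f x|.
  have /existsNP[u /negP] := H n; rewrite -ltNge => ?; by exists u.
have [G [UG Goo]] := ultraFilterLemma (F := \oo) _.
have /cvgrPdist_le/(_ _ e0) := @cesaro_ultra_cvg G UG Goo (fun n => sval (cid (H n))) f bf.
case/filter_ex => n; rewrite leNgt => /negP; apply.
by case: cid => u /=; rewrite distrC.
Qed.

Lemma pi_kop f : bounded_measurable f -> \int[pi]_x kop K f x = \int[pi]_x f x.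
Proof.
have piM : mean (fun f => \int[pi]_x f x).
  by apply: mean_Rintegral; exact: probability_setT.
apply: (mean_eq (L := fun f => \int[pi]_x kop K f x)) => //; last first.
  move=> B mB; have [inv _] := pi_invariant; rewrite /Rintegral.
  under eq_integral do rewrite kop_indic//.
  by rewrite -inv// integral_indic// setIT.
split => [g h bg bh|c g bg|g bg g0|].
- rewrite (_ : kop K _ = fun u => kop K g u + kop K h u); last first.
    by apply/funext => u; rewrite (meanD (mean_kop K u)).
  by rewrite (meanD piM)//; exact: kop_bounded_measurable.
- rewrite (_ : kop K _ = fun u => c * kop K g u); last first.
    by apply/funext => u; rewrite (meanZ (mean_kop K u)).
  by rewrite (meanZ piM)//; exact: kop_bounded_measurable.
- apply: Rintegral_ge0 => u _.
  by case: (mean_kop K u) => _ _ + _; exact.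
- rewrite (_ : kop K _ = fun=> 1) ?(mean_cst piM)//.
  by apply/funext => u; rewrite (mean_cst (mean_kop K u)).
Qed.

(* The solution is the Cesaro mean of the partial sums of the Neumann series. *)
Lemma approximate_poisson_equation f (e : R) : continuous f -> 0 < e ->
  exists2 g : S -> R, continuous g /\ (forall u, 0 <= g u) &
    forall u, `|g u - kop K g u - (f u - \int[pi]_x f x)| <= e.
Proof.
move=> cf e0; have bf := continuous_bounded_measurable compactS cf.
(* Applied to K f rather than f: the partial sums with 1 to n + 1 terms telescope to f - K^j f for j
   = 1, ..., n + 1, whose average is f minus the Cesaro mean of K f. Invariance gives pi(K f) =
   pi(f). *)
have [n nE] := uniform_ergodicity (kop_bounded_measurable K bf) e0.
pose s m u := \sum_(j < m) iter j (kop K) f u.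
have cit j : continuous (iter j (kop K) f).
  by elim: j => //= j; exact: kop_continuous.
have cs m : continuous (s m) by exact: continuous_sum.
have sK m u : s m u - kop K (s m) u = f u - iter m (kop K) f u.
  rewrite /s (mean_sum (mean_kop K u)); last first.
    by move=> j; exact: iter_kop_bounded_measurable.
  by elim: m => [|m ih]; rewrite ?big_ord0 ?subrr// !big_ord_recr/=; lra.
pose g0 u := n.+1%:R^-1 * \sum_(m < n.+1) s m.+1 u.
have cg0 : continuous g0.
  move=> u; apply: cvgMr; apply: continuous_sum => m; exact: cs.
have [_ [M gM]] := continuous_bounded_measurable compactS cg0.
have bs m := continuous_bounded_measurable compactS (cs m).
have g0K u : g0 u - kop K g0 u = f u - cesaro n (kop K f) u.
  rewrite /g0 (meanZ (mean_kop K u)); last by apply: bounded_measurable_sum.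
  rewrite (mean_sum (mean_kop K u)) ?bs// -mulrBr -sumrB.
  rewrite (eq_bigr (fun m : 'I_n.+1 => f u - iter m (kop K) (kop K f) u)); last first.
    by move=> m _; rewrite sK iterSr.
  rewrite sumrB mulrBr; congr (_ - _).
  by rewrite sumr_const card_ord -[X in _ * X]mulr_natl mulKf.
(* Adding a constant makes the solution nonnegative and leaves g - K g unchanged. *)
exists (fun u => g0 u + M).
  split => u; first by apply: cvgD; [exact: cg0|exact: cvg_cst].
  by have := gM u; rewrite ler_norml; lra.
move=> u; rewrite (meanD (mean_kop K u)); last 2 first.
- exact: continuous_bounded_measurable.
- exact: bounded_measurable_cst.
have := nE u; rewrite (mean_cst (mean_kop K u)) pi_kop//.
have := g0K u; set A := g0 u; set B := kop K g0 u => AB.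
have -> : A + M - (B + M) - (f u - \int[pi]_x f x) =
  - (cesaro n (kop K f) u - \int[pi]_x f x) by lra.
by rewrite normrN.
Qed.

End uniform_ergodicity.

(** * Markov processes and Lyapunov criteria *)

Section kernel_integrals.
Import HBNNSimple.
Context d1 d2 (X : measurableType d1) (Y : measurableType d2) (R : realType).
Context (mu : {measure set X -> \bar R}) (D : set X) (mD : measurable D).
Local Open Scope ereal_scope.

Lemma integral_kernel_nnsfun (k : X -> {measure set Y -> \bar R})
    (f : {nnsfun Y >-> R}) :
  (forall U, measurable U -> measurable_fun setT (k ^~ U)) ->
  \int[mu]_(x in D) \int[k x]_y (f y)%:E =
  \sum_(r \in range f) (r%:E * \int[mu]_(x in D) k x (f @^-1` [set r])).
Proof.
move=> mk; have mf r : measurable (f @^-1` [set r]) by exact: measurable_sfunP.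
have mkf r : measurable_fun D (k ^~ (f @^-1` [set r])).
  by apply: measurable_funTS; exact: mk.
under eq_integral => x _.
  rewrite integralT_nnsfun sintegralE; over.
rewrite ge0_integral_fsum//; last 2 first.
- by move=> r; exact: measurable_funeM.
- by move=> r x _; exact: nnsfun_mulemu_ge0.
apply: eq_fsbigr => r; rewrite inE => -[y _ <-].
by rewrite ge0_integralZl// lee_fin.
Qed.

(** Monotone approximation by simple functions. This extends the Markov property from sets to
    nonnegative functions. *)
Lemma integral_kernel_eq (k k' : X -> {measure set Y -> \bar R}) (f : Y -> \bar R) :
  (forall U, measurable U -> measurable_fun setT (k ^~ U)) ->
  (forall U, measurable U -> measurable_fun setT (k' ^~ U)) ->
  (forall U, measurable U ->
    \int[mu]_(x in D) k x U = \int[mu]_(x in D) k' x U) ->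
  measurable_fun setT f -> (forall y, 0 <= f y) ->
  \int[mu]_(x in D) \int[k x]_y f y = \int[mu]_(x in D) \int[k' x]_y f y.
Proof.
move=> mk mk' kk' mf f0.
pose f_ := nnsfun_approx measurableT mf.
have key (l : X -> {measure set Y -> \bar R}) :
    (forall U, measurable U -> measurable_fun setT (l ^~ U)) ->
    \int[mu]_(x in D) \int[l x]_y f y =
    lim (\int[mu]_(x in D) \int[l x]_y (f_ n y)%:E @[n --> \oo]).
  move=> ml; rewrite -monotone_convergence//; last 3 first.
  - move=> n; apply: measurable_funTS; apply: measurable_fun_integral_kernel => //.
      by move=> y; rewrite lee_fin.
    exact/measurable_EFinP.
  - by move=> n x _; apply: integral_ge0 => y _; rewrite lee_fin.
  - move=> x _ a b ab; apply: ge0_le_integral => //.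
    + by move=> y _; rewrite lee_fin.
    + exact/measurable_EFinP.
    + exact/measurable_EFinP.
    + by move=> y _; rewrite lee_fin; exact/lefP/nd_nnsfun_approx.
  apply: eq_integral => x _; rewrite -monotone_convergence//; last 3 first.
  - by move=> n; exact/measurable_EFinP.
  - by move=> n y _; rewrite lee_fin.
  - by move=> y _ a b ab; rewrite lee_fin; exact/lefP/nd_nnsfun_approx.
  by apply: eq_integral => y _; apply/esym/cvg_lim => //; exact: cvg_nnsfun_approx.
have E n : \int[mu]_(x in D) \int[k x]_y (f_ n y)%:E =
    \int[mu]_(x in D) \int[k' x]_y (f_ n y)%:E.
  rewrite !integral_kernel_nnsfun//; apply: eq_fsbigr => r _.
  by rewrite kk'//; exact: measurable_sfunP.
by rewrite !key// (funext E).
Qed.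

End kernel_integrals.

Section markov.
Context (R : realType) (dO : measure_display) (Omega : measurableType dO)
  (P : probability Omega R) (d : measure_display) (S : borelMetricType d R)
  (Ks : R.-pker (half_strip R S) ~> (half_strip R S)) (z : half_strip R S)
  (F : nat -> set_system Omega) (xi : nat -> Omega -> half_strip R S).
Hypothesis mp : markov_process P Ks z F xi.
Local Open Scope ereal_scope.
Implicit Types (f h : half_strip R S -> \bar R) (D : set (half_strip R S))
  (G : set Omega).

Lemma filtration_measurable n G : F n G -> measurable G.
Proof. by move=> FG; have [_ Fm _] := mp_filtration mp; exact: (Fm n). Qed.

Lemma filtrationS n G : F n G -> F n.+1 G.
Proof. by have [_ _ mono] := mp_filtration mp; exact: (mono n n.+1 (leqnSn n)). Qed.

Lemma filtrationT n : F n setT.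
Proof.
have [/(_ n)[F0 FC _] _ _] := mp_filtration mp.
by rewrite -(setD0 setT); exact: FC.
Qed.

Lemma filtrationI n G G' : F n G -> F n G' -> F n (G `&` G').
Proof.
have [/(_ n) sF _ _] := mp_filtration mp.
by have [_ _ _] := (sigma_algebraP (fun X _ => @subsetT _ X)).1 sF; exact.
Qed.

End markov.

Section region.
Context (R : realType) (dO : measure_display) (Omega : measurableType dO)
  (P : probability Omega R) (d : measure_display) (S : borelMetricType d R)
  (Ks : R.-pker (half_strip R S) ~> (half_strip R S)) (z : half_strip R S)
  (F : nat -> set_system Omega) (xi : nat -> Omega -> half_strip R S).
Hypothesis mp : markov_process P Ks z F xi.
Local Open Scope ereal_scope.
Implicit Types (f h : half_strip R S -> \bar R) (D : set (half_strip R S))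
  (G : set Omega).

Lemma measurable_process n : measurable_fun setT (xi n).
Proof.
move=> _ A mA; rewrite setTI; apply: (filtration_measurable mp (n := n)).
exact: (mp_adapted mp).
Qed.

Lemma markov_integral n G f : F n G -> measurable_fun setT f ->
  (forall x, 0 <= f x) ->
  \int[P]_(w in G) f (xi n.+1 w) = \int[P]_(w in G) \int[Ks (xi n w)]_y f y.
Proof.
move=> FG mf f0; have mG := filtration_measurable mp FG.
(* The next state is viewed as the random Dirac kernel at it, to be compared with [Ks]. *)
transitivity (\int[P]_(w in G) \int[\d_(xi n.+1 w)]_y f y).
  by apply: eq_integral => w _; rewrite integral_dirac// diracT mul1e.
apply: integral_kernel_eq => //.
- move=> U mU; rewrite (_ : (fun w => _) = EFin \o (\1_U \o xi n.+1)).
    apply/measurable_EFinP; apply: measurableT_comp => //.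
    exact: measurable_process.
  by apply/funext => w; rewrite /= diracE indicE.
- move=> U mU; apply: (measurableT_comp (f := fun x => Ks x U)).
    exact: measurable_kernel.
  exact: measurable_process.
- move=> U mU; have [_ /(_ G FG) ->] := mp_markov mp n mU.
  by apply: eq_integral => w _; rewrite /= diracE indicE.
Qed.

(** Replaces stopping times: on the event G of time m, the first exit from D has not occurred at
    times m, ..., m + k - 1. The strict bound makes [alive m D G k.+1] an event of time m + k, to
    which the Markov property applies. *)
Definition alive m D G k := G `&` [set w | forall j, (j < k)%N -> D (xi (m + j) w)].

Lemma alive0 m D G : alive m D G 0 = G.
Proof. by apply/seteqP; split => w; [case|split]. Qed.

Lemma aliveS m D G k :
  alive m D G k.+1 = alive m D G k `&` xi (m + k) @^-1` D.
Proof.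
apply/seteqP; split => w [Gw Dw].
  by split; [split=> // j jk; apply: Dw; exact: ltnW|exact: Dw].
case: Gw => Gw H; split=> // j; rewrite ltnS leq_eqVlt => /orP[/eqP ->//|].
exact: H.
Qed.

Section fixed_region.
Context (m : nat) (D : set (half_strip R S)) (G : set Omega).
Hypotheses (mD : measurable D) (FG : F m G).

Lemma filtration_alive k : F (m + k) (alive m D G k) /\ F (m + k) (alive m D G k.+1).
Proof.
have step k' : F (m + k') (alive m D G k') -> F (m + k') (alive m D G k'.+1).
  move=> H; rewrite aliveS; apply: (filtrationI mp) => //; exact: (mp_adapted mp).
suff H : F (m + k) (alive m D G k) by split=> //; exact: step.
elim: k => [|k ih]; first by rewrite alive0 addn0.
by rewrite addnS; apply: (filtrationS mp); exact: step.
Qed.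

Lemma measurable_alive k : measurable (alive m D G k).
Proof. by have [H _] := filtration_alive k; exact: (filtration_measurable mp H). Qed.

Definition exit_set k := alive m D G k `&` xi (m + k) @^-1` (~` D).

Lemma measurable_exit k : measurable (exit_set k).
Proof.
apply: measurableI; first exact: measurable_alive.
rewrite -[X in measurable X]setTI; apply: measurable_process => //.
exact: measurableC.
Qed.

Lemma trivIset_exit : trivIset setT exit_set.
Proof.
apply/trivIsetP => i j _ _; rewrite neq_lt => /orP[] ij;
  rewrite -subset0 => w [[[_ A] B] [[_ A'] B']].
- by apply: B; exact: A'.
- by apply: B'; exact: A.
Qed.

Let E f k := \int[P]_(w in alive m D G k) f (xi (m + k) w).

Let split_alive f k : measurable_fun setT f -> (forall x, 0 <= f x) ->
  E f k = \int[P]_(w in alive m D G k.+1) f (xi (m + k) w) +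
          \int[P]_(w in exit_set k) f (xi (m + k) w).
Proof.
move=> mf f0; rewrite -ge0_integral_setU//; last 4 first.
- exact: measurable_alive.
- exact: measurable_exit.
- apply: measurable_funTS; apply: measurableT_comp => //; exact: measurable_process.
- by rewrite aliveS disj_set2E; apply/eqP; rewrite -subset0 => w [[_ ?] [_]].
by rewrite aliveS /exit_set -setIUr -preimage_setU setUCr preimage_setT setIT.
Qed.

Let mKs f : measurable_fun setT f -> (forall x, 0 <= f x) ->
  measurable_fun setT (fun x => \int[Ks x]_y f y).
Proof.
by move=> mf f0; apply: measurable_fun_integral_kernel => // U mU; exact: measurable_kernel.
Qed.

Let mxi f k A : measurable_fun setT f -> measurable_fun A (fun w => f (xi k w)).
Proof.
move=> mf; apply: measurable_funTS; apply: measurableT_comp => //.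
exact: measurable_process.
Qed.

Let alive_step f k : measurable_fun setT f -> (forall x, 0 <= f x) ->
  E f k.+1 = \int[P]_(w in alive m D G k.+1) \int[Ks (xi (m + k) w)]_y f y.
Proof.
move=> mf f0; rewrite /E addnS; apply: markov_integral => //.
by have [] := filtration_alive k.
Qed.

(** Optional stopping at the exit from D: the initial budget of f pays the running cost h while
    alive and the value of f at the exit. *)
Lemma supermartingale_region f h : measurable_fun setT f -> (forall x, 0 <= f x) ->
  measurable_fun setT h -> (forall x, 0 <= h x) ->
  (forall x, D x -> \int[Ks x]_y f y + h x <= f x) ->
  forall n, \sum_(k < n) (\int[P]_(w in alive m D G k.+1) h (xi (m + k) w) +
                          \int[P]_(w in exit_set k) f (xi (m + k) w)) <=
    \int[P]_(w in G) f (xi m w).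
Proof.
move=> mf f0 mh h0 fh n.
(* The induction must keep the part of f still alive at time n; it is dropped only at the end. *)
suff H : \sum_(k < n) (\int[P]_(w in alive m D G k.+1) h (xi (m + k) w) +
    \int[P]_(w in exit_set k) f (xi (m + k) w)) + E f n <= \int[P]_(w in G) f (xi m w).
  apply: le_trans H; rewrite leeDl//; apply: integral_ge0 => w _; exact: f0.
elim: n => [|n ih]; first by rewrite big_ord0 add0e /E alive0 addn0.
apply: le_trans ih; rewrite big_ord_recr/= -addeA; apply: leeD2l.
rewrite [E f n]split_alive// addeAC; apply: leeD2r.
rewrite alive_step// addeC -ge0_integralD//; last 4 first.
- exact: measurable_alive.
- by move=> w _; apply: integral_ge0.
- by apply: (mxi (f := fun x => \int[Ks x]_y f y)); exact: mKs.
- exact: mxi.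
apply: ge0_le_integral => //.
- exact: measurable_alive.
- by move=> w _; apply: adde_ge0 => //; apply: integral_ge0.
- apply: emeasurable_funD; last exact: mxi.
  by apply: (mxi (f := fun x => \int[Ks x]_y f y)); exact: mKs.
- exact: mxi.
- by move=> w [_ Dw]; apply: fh; exact: Dw.
Qed.

Lemma submartingale_region f : measurable_fun setT f -> (forall x, 0 <= f x) ->
  (forall x, D x -> f x <= \int[Ks x]_y f y) ->
  forall n, \int[P]_(w in G) f (xi m w) <=
    \int[P]_(w in alive m D G n) f (xi (m + n) w) +
    \sum_(k < n) \int[P]_(w in exit_set k) f (xi (m + k) w).
Proof.
move=> mf f0 ff; elim=> [|n ih]; first by rewrite big_ord0 adde0 alive0 addn0.
apply: le_trans ih _; rewrite -/(E f n) -/(E f n.+1) split_alive// big_ord_recr/=.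
rewrite -addeA [X in _ + X <= _]addeC; apply: leeD2r.
rewrite alive_step//; apply: ge0_le_integral => //.
- exact: measurable_alive.
- exact: mxi.
- by apply: (mxi (f := fun x => \int[Ks x]_y f y)); exact: mKs.
- by move=> w [_ Dw]; apply: ff; exact: Dw.
Qed.

Lemma growth_region f h : measurable_fun setT f -> (forall x, 0 <= f x) ->
  measurable_fun setT h -> (forall x, 0 <= h x) ->
  (forall x, D x -> \int[Ks x]_y f y <= f x + h x) ->
  forall n, \int[P]_(w in alive m D G n) f (xi (m + n) w) <=
    \int[P]_(w in G) f (xi m w) +
    \sum_(k < n) \int[P]_(w in alive m D G k.+1) h (xi (m + k) w).
Proof.
move=> mf f0 mh h0 fh; elim=> [|n ih]; first by rewrite big_ord0 adde0 alive0 addn0.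
rewrite big_ord_recr/= addeA.
apply: (@le_trans _ _ (E f n + \int[P]_(w in alive m D G n.+1) h (xi (m + n) w)));
  last exact: leeD2r.
rewrite split_alive// addeAC; apply: (@le_trans _ _
    (\int[P]_(w in alive m D G n.+1) (f (xi (m + n) w) + h (xi (m + n) w)))); last first.
  rewrite ge0_integralD//; last 3 first.
  - exact: measurable_alive.
  - exact: mxi.
  - exact: mxi.
  by rewrite leeDl//; apply: integral_ge0.
rewrite -/(E f n.+1) alive_step//; apply: ge0_le_integral => //.
- exact: measurable_alive.
- by move=> w _; apply: integral_ge0.
- by apply: (mxi (f := fun x => \int[Ks x]_y f y)); exact: mKs.
- by apply: emeasurable_funD; exact: mxi.
- by move=> w [_ Dw]; apply: fh; exact: Dw.
Qed.

End fixed_region.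
End region.

Section sequences_facts.
Context (R : realType).
Implicit Type u : nat -> R.

Lemma limn_esup_pinfty_ge u m M : limn_esup (fun n => (u n)%:E) = +oo%E ->
  exists k, M <= u (m + k)%N.
Proof.
move=> uoo; apply: contrapT => /forallNP uM.
suff : (limn_esup (fun n => (u n)%:E) <= M%:E)%E by rewrite uoo leye_eq.
apply: ereal_inf_le; exists (ereal_sup ((fun n => (u n)%:E) @` [set n | (m <= n)%N])).
  by exists [set n | (m <= n)%N] => //; exists m.
apply: ge_ereal_sup => _ [n /= mn <-]; rewrite lee_fin leNgt; apply/negP => Mn.
by apply: (uM (n - m)%N); rewrite subnKC// ltW.
Qed.

Lemma limn_einf_le u r : (forall m, exists k, u (m + k)%N <= r) ->
  (limn_einf (fun n => (u n)%:E) <= r%:E)%E.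
Proof.
move=> ur; rewrite limn_einf_lim.
apply: lime_le; first exact: is_cvg_einfs.
apply: nearW => m; have [k urk] := ur m.
apply: ereal_inf_le; exists (u (m + k)%N)%:E; last by rewrite lee_fin.
by exists (m + k)%N => //=; rewrite leq_addr.
Qed.

End sequences_facts.

Lemma negligible_small d (T : measurableType d) (R : realType)
    (mu : {measure set T -> \bar R}) (A : set T) :
  (forall e : R, 0 < e -> exists B, [/\ measurable B, A `<=` B & (mu B <= e%:E)%E]) ->
  mu.-negligible A.
Proof.
move=> H; have e0 n : 0 < (n.+1%:R^-1 : R) by rewrite invr_gt0.
pose B n := sval (cid (H _ (e0 n))).
have BP n : [/\ measurable (B n), A `<=` B n & (mu (B n) <= (n.+1%:R^-1)%:E)%E].
  by rewrite /B; case: cid.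
exists (\bigcap_n B n); split.
- by apply: bigcapT_measurable => n; have [] := BP n.
- apply/eqP; rewrite eq_le measure_ge0 andbT; apply/lee_addgt0Pr => e e_gt0.
  rewrite add0e; have [n _ /(_ n (leqnn n))] : \forall n \near \oo, n.+1%:R^-1 <= e.
    have /cvgrPdist_le/(_ _ e_gt0) := @cvg_harmonic R.
    by apply: filterS => n; rewrite /= sub0r normrN gtr0_norm ?invr_gt0.
  rewrite -lee_fin => ne; apply: le_trans ne; have [mB _ Bn] := BP n.
  apply: le_trans Bn; apply: le_measure; rewrite ?inE//.
    by apply: bigcapT_measurable => k; have [] := BP k.
  exact: bigcap_inf.
- by move=> w Aw n _; have [_ + _] := BP n; exact.
Qed.

(** * Recurrence and transience from supermartingales *)

Section criteria.
Context (R : realType) (dO : measure_display) (Omega : measurableType dO)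
  (P : probability Omega R) (d : measure_display) (S : borelMetricType d R)
  (Ks : R.-pker (half_strip R S) ~> (half_strip R S)) (z : half_strip R S)
  (F : nat -> set_system Omega) (xi : nat -> Omega -> half_strip R S).
Hypothesis mp : markov_process P Ks z F xi.

(** The bad event for recurrence. Here and in [not_escaping], the first clause expresses limsup X_n
    = +oo: non-confinement is part of the event rather than a hypothesis of the criteria. *)
Definition eventually_above (r : R) := [set w |
  (forall m M, exists k, M <= radial xi (m + k) w) /\
  exists m, forall k, r < radial xi (m + k) w].

Definition not_escaping (r : R) := [set w |
  (forall m M, exists k, M <= radial xi (m + k) w) /\
  forall m, exists k, radial xi (m + k) w <= r].

Local Open Scope ereal_scope.
Implicit Types (V : half_strip R S -> R) (D A : set (half_strip R S)).

Local Notation above r := [set x : half_strip R S | (r < x.1%:num)%R].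

Lemma measurable_radius : measurable_fun setT (fun x : half_strip R S => x.1%:num : R).
Proof.
apply: (measurableT_comp (f := fun x : half_line R => x%:num : R)).
  by move=> _ B mB; rewrite setTI; exists B => //; rewrite setTI.
exact: measurable_fst.
Qed.

Lemma measurable_above r : measurable (above r).
Proof.
rewrite -[X in measurable X]setTI.
by apply: (measurable_fun_ltr (f := cst r)) => //; exact: measurable_radius.
Qed.

Lemma measurable_along_process V k (A : set Omega) : measurable_fun setT V ->
  measurable_fun A (fun w => (V (xi k w))%:E).
Proof.
move=> mV; apply/measurable_EFinP; apply: measurable_funTS.
by apply: measurableT_comp => //; exact: (measurable_process mp).
Qed.

(** Maximal inequality: exits at different times are disjoint, and an exit into A costs at least l
    of the initial budget. *)
Lemma exit_probability m D G V A (l : R) : measurable D -> F m G ->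
  measurable_fun setT V -> (forall x, 0 <= V x)%R ->
  (forall x, D x -> \int[Ks x]_y (V y)%:E <= (V x)%:E) ->
  measurable A -> (0 < l)%R -> (forall x, A x -> l <= V x)%R ->
  l%:E * P (\bigcup_k (exit_set xi m D G k `&` xi (m + k) @^-1` A)) <=
  \int[P]_(w in G) (V (xi m w))%:E.
Proof.
move=> mD FG mV V0 DV mA l0 AV.
have mx k : measurable (xi (m + k) @^-1` A).
  by rewrite -[X in measurable X]setTI; exact: (measurable_process mp).
have mE k := measurable_exit mp mD FG k.
rewrite measure_semi_bigcup//; last 3 first.
- by move=> k; exact: measurableI.
- by apply: trivIset_setIr; exact: trivIset_exit.
- by apply: bigcup_measurable => k _; exact: measurableI.
rewrite -nneseriesZl//; apply: lime_le.
  by apply: is_cvg_nneseries => k _ _; rewrite mule_ge0// lee_fin ltW.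
apply: nearW => n; rewrite big_mkord.
have mEV : measurable_fun setT (EFin \o V) by exact/measurable_EFinP.
have EV0 x : 0 <= (EFin \o V) x by rewrite lee_fin.
have H := supermartingale_region mp mD FG mEV EV0 (measurable_cst (0 : \bar R))
  (fun=> lexx 0) _ n.
apply: le_trans (H _); last by move=> x Dx; rewrite adde0; exact: DV.
apply: lee_sum => k _; rewrite integral0 add0e.
apply: (@le_trans _ _ (\int[P]_(w in exit_set xi m D G k `&` xi (m + k) @^-1` A)
    (V (xi (m + k) w))%:E)).
  rewrite -integral_cst//; last exact: measurableI.
  apply: ge0_le_integral => //.
  - exact: measurableI.
  - by move=> w _; rewrite lee_fin ltW.
  - exact: measurable_along_process.
  - by move=> w [_ Aw]; rewrite lee_fin; exact: AV.
apply: ge0_subset_integral => //.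
- exact: measurableI.
- exact: measurable_along_process.
by move=> w _; rewrite lee_fin.
Qed.

Lemma filtration_preimage n A : measurable A -> F n (xi n @^-1` A).
Proof. exact: (mp_adapted mp). Qed.


(** A path that stays above r and is unbounded reaches every level of V, but from a bounded set it
    reaches level l before returning with probability at most C/l. Countably many starting times and
    bounds cover the bad event. *)
Lemma recurrence_criterion V (r : R) : measurable_fun setT V ->
  (forall x, 0 <= V x)%R ->
  (forall x, above r x -> \int[Ks x]_y (V y)%:E <= (V x)%:E) ->
  (forall M, exists L, forall x : half_strip R S, L <= x.1%:num -> M <= V x)%R ->
  (forall N, exists C, forall x : half_strip R S, x.1%:num <= N -> V x <= C)%R ->
  P.-negligible (eventually_above r).
Proof.
move=> mV V0 DV Vcoercive Vbounded.
pose Bad N m := [set w | [/\ (radial xi m w <= N%:R)%R,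
  (forall M, exists k, M <= radial xi (m + k) w)%R &
  forall k, (r < radial xi (m + k) w)%R]].
apply: (@negligibleS _ _ _ _ (\bigcup_N \bigcup_m Bad N m)).
  move=> w [wM [m wr]]; exists (Num.truncn (radial xi m w)).+1 => //; exists m => //.
  by split => //; exact/ltW/truncnS_gt.
apply: negligible_bigcup => N; apply: negligible_bigcup => m.
apply: negligible_small => e e0.
have [C VC] := Vbounded N%:R.
pose C' := (Num.max C 1)%R; have C'0 : (0 < C')%R by rewrite lt_max ltr01 orbT.
(* With this level the bound C'/l is exactly e. *)
pose l := (C' / e)%R; have l0 : (0 < l)%R by rewrite divr_gt0.
pose A := [set x | l <= V x]%R.
have mA : measurable A.
  rewrite -[X in measurable X]setTI.
  by apply: (measurable_fun_le (f := cst l)).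
pose D := above r `&` ~` A.
have mD : measurable D.
  by apply: measurableI; [exact: measurable_above|exact: measurableC].
pose G := xi m @^-1` [set x | x.1%:num <= N%:R]%R.
have FG : F m G.
  apply: filtration_preimage; rewrite -[X in measurable X]setTI.
  by apply: (measurable_fun_le (g := cst N%:R)) => //; exact: measurable_radius.
pose B := \bigcup_k (exit_set xi m D G k `&` xi (m + k) @^-1` A).
exists B; split.
- apply: bigcup_measurable => k _; apply: measurableI.
    exact: (measurable_exit mp).
  by rewrite -[X in measurable X]setTI; exact: (measurable_process mp).
- move=> w [wN wM wr]; have [L VL] := Vcoercive l.
  have [k0 k0L] := wM L.
  (* The path never goes below r, so its first visit to [A] is its exit from [D]. *)
  have ex : exists k, `[< A (xi (m + k) w) >] by exists k0; apply/asboolP; exact: VL.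
  have := ex_minnP ex; case => k /asboolP Ak kmin.
  exists k => //; split => //; split; last by move=> [].
  split => // j jk; split; first exact: wr.
  by move=> Aj; have := kmin j; rewrite asboolT// => /(_ isT); rewrite leqNgt jk.
- have DV' x : D x -> \int[Ks x]_y (V y)%:E <= (V x)%:E by move=> [/DV].
  have := exit_probability mD FG mV V0 DV' mA l0 (fun x Ax => Ax).
  rewrite -/B => H.
  have {}H : l%:E * P B <= C'%:E.
    apply: le_trans H _.
    have mG := filtration_measurable mp FG.
    apply: (@le_trans _ _ (\int[P]_(w in G) C'%:E)).
      apply: ge0_le_integral => //.
      + by move=> w _; rewrite lee_fin.
      + exact: measurable_along_process.
      + by move=> w Gw; rewrite lee_fin le_max VC.
    rewrite integral_cst// -[leRHS]mule1 lee_pmul2l ?lte_fin//.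
    exact: probability_le1.
  rewrite -(@lee_pmul2l _ l%:E) ?lte_fin// -EFinM.
  by apply: le_trans H _; rewrite lee_fin /l divfK// gt_eqF.
Qed.


(** Beyond a far level L the budget is at most e c, while a return below r costs c; hence a return
    after the first passage over L has probability at most e. *)
Lemma transience_criterion V (r c : R) : measurable_fun setT V ->
  (forall x, 0 <= V x)%R ->
  (forall x, above r x -> \int[Ks x]_y (V y)%:E <= (V x)%:E) ->
  (0 < c)%R -> (forall x : half_strip R S, x.1%:num <= r -> c <= V x)%R ->
  (forall e, 0 < e -> exists L, forall x : half_strip R S, L <= x.1%:num -> V x <= e)%R ->
  P.-negligible (not_escaping r).
Proof.
move=> mV V0 DV c0 Vc Vsmall; apply: negligible_small => e e0.
have [L VL] := Vsmall _ (mulr_gt0 e0 c0).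
pose D' := [set x : half_strip R S | x.1%:num < L]%R.
have mD' : measurable D'.
  rewrite -[X in measurable X]setTI.
  by apply: (measurable_fun_ltr (g := cst L)) => //; exact: measurable_radius.
(* The first passage over L occurs at time m. These events are disjoint, so the bounds e P(G m) on
   the returns add up to at most e. *)
pose G m := exit_set xi 0 D' setT m.
have FG m : F m (G m).
  apply: (filtrationI mp).
    by have [+ _] := filtration_alive mp mD' (filtrationT mp 0) m.
  by apply: filtration_preimage; exact: measurableC.
have mG m : measurable (G m) by exact: (filtration_measurable mp (FG m)).
pose A := [set x : half_strip R S | x.1%:num <= r]%R.
have mA : measurable A.
  rewrite -[X in measurable X]setTI.
  by apply: (measurable_fun_le (g := cst r)) => //; exact: measurable_radius.
pose B m := \bigcup_k (exit_set xi m (above r) (G m) k `&` xi (m + k) @^-1` A).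
have mB m : measurable (B m).
  apply: bigcup_measurable => k _; apply: measurableI.
    by apply: (measurable_exit mp) => //; exact: measurable_above.
  by rewrite -[X in measurable X]setTI; exact: (measurable_process mp).
exists (\bigcup_m B m); split.
- exact: bigcup_measurable.
- move=> w [wM wr]; have [m0 m0L] := wM 0%N L.
  have ex : exists m, `[< ~ D' (xi m w) >].
    by exists m0; apply/asboolP => /=; apply/negP; rewrite -leNgt.
  have := ex_minnP ex; case => m /asboolP Dm mmin.
  exists m => //; have [k1 k1r] := wr m.
  have ex' : exists k, (radial xi (m + k) w <= r)%R by exists k1.
  have := ex_minnP ex'; case => k kr kmin.
  exists k => //; split => //; split; last first.
    by rewrite /= ltNge; apply/negP; rewrite negbK.
  split.
    split=> //; split=> // j jm; apply: contrapT => Dj.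
    by have := mmin j; rewrite asboolT// => /(_ isT); rewrite leqNgt jm.
  move=> j jk /=; rewrite ltNge; apply/negP => /kmin.
  by rewrite leqNgt jk.
- have PB m : P (B m) <= e%:E * P (G m).
    have := exit_probability (measurable_above r) (FG m) mV V0 DV mA c0 Vc.
    rewrite -/(B m) => H; rewrite -(@lee_pmul2l _ c%:E) ?lte_fin// muleA -EFinM mulrC.
    apply: le_trans H _.
    apply: (@le_trans _ _ (\int[P]_(w in G m) (e * c)%:E)); last by rewrite integral_cst.
    apply: ge0_le_integral => //.
    + by move=> w _; rewrite lee_fin.
    + exact: measurable_along_process.
    + move=> w [_ /negP]; rewrite -leNgt => Lw.
      by rewrite lee_fin; exact: VL.
  apply: le_trans (generalized_Boole_inequality P mB _) _.
    exact: bigcup_measurable.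
  apply: (@le_trans _ _ (\sum_(0 <= m <oo) e%:E * P (G m))).
    by apply: lee_nneseries => *; [exact: measure_ge0|exact: PB].
  rewrite nneseriesZl// -[leRHS]mule1 lee_pmul2l ?lte_fin//.
  rewrite -measure_semi_bigcup//; last 2 first.
  - exact: trivIset_exit.
  - exact: bigcup_measurable.
  by apply: probability_le1; exact: bigcup_measurable.
Qed.

End criteria.

(** * Expected hitting times: Foster's criterion and null recurrence *)

Section hitting_times.
Context (R : realType) (dO : measure_display) (Omega : measurableType dO)
  (P : probability Omega R) (d : measure_display) (S : borelMetricType d R)
  (Ks : R.-pker (half_strip R S) ~> (half_strip R S)) (z : half_strip R S)
  (F : nat -> set_system Omega) (xi : nat -> Omega -> half_strip R S).
Hypothesis mp : markov_process P Ks z F xi.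
Local Open Scope ereal_scope.
Implicit Types (V W : half_strip R S -> R).

Local Notation above r := [set x : half_strip R S | (r < x.1%:num)%R].

Let A r k := alive xi 0 (above r) setT k.

Let mA r k : measurable (A r k).
Proof.
by apply: (measurable_alive mp); [exact: measurable_above|exact: (filtrationT mp)].
Qed.

Lemma le_hitting_time r r' w : (r <= r')%R ->
  hitting_time xi r' w <= hitting_time xi r w.
Proof.
move=> rr'; apply: ereal_inf_le_tmp => _ [n /= nr <-]; exists n => //=.
exact: le_trans nr rr'.
Qed.

(** tau is the sum over k of the indicators of tau > k, and tau > k means that times 0, ..., k are
    all above r, which is [A r k.+1]. *)
Lemma hitting_timeE r w :
  hitting_time xi r w = \sum_(0 <= k <oo) (\1_(A r k.+1) w)%:E.
Proof.
have [H|H] := pselect (exists n, (radial xi n w <= r)%R).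
- have [n nr nmin] := ex_minnP H.
  have Ak k : (\1_(A r k.+1) w : R) = (k < n)%N%:R.
    rewrite indicE; congr (_%:R); congr nat_of_bool; apply/idP/idP.
      move=> /set_mem[_ /= Aw]; rewrite ltnNge; apply/negP => nk.
      by have := Aw n nk; rewrite ltNge nr.
    move=> kn; apply/mem_set; split=> // j jk /=; rewrite ltNge; apply/negP => /nmin.
    by rewrite leqNgt (leq_ltn_trans _ kn).
  have -> : hitting_time xi r w = n%:R%:E.
    apply/eqP; rewrite eq_le; apply/andP; split.
      by apply: ereal_inf_lbound; exists n.
    by apply: le_ereal_inf_tmp => _ [k /= /nmin nk <-]; rewrite lee_fin ler_nat.
  rewrite (nneseries_split 0 n) => [|k _]; last by rewrite lee_fin.
  rewrite eseries0 ?adde0; last by move=> k nk _; rewrite Ak ltnNge nk.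
  rewrite add0n big_mkord (eq_bigr (fun=> 1%:E)).
    by rewrite sumEFin sumr_const card_ord.
  by move=> k _; rewrite Ak ltn_ord.
- have Ak k : (\1_(A r k.+1) w : R) = 1%R.
    rewrite indicE mem_set//; split=> // j _ /=; rewrite ltNge; apply/negP => jr.
    by apply: H; exists j.
  have -> : hitting_time xi r w = +oo.
    rewrite /hitting_time (_ : [set _ | _ in _] = set0) ?ereal_inf0//.
    by rewrite -subset0 => _ [n /= nr _]; apply: H; exists n.
  apply/esym/eqyP => M M0; pose n := (Num.truncn M).+1.
  apply: le_trans (nneseries_lim_ge n _); last by move=> k _ _; rewrite lee_fin.
  rewrite big_mkord (eq_bigr (fun=> 1%:E)); last by move=> k _; rewrite Ak.
  by rewrite sumEFin sumr_const card_ord lee_fin; exact/ltW/truncnS_gt.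
Qed.

Lemma hitting_time_ge0 r w : 0 <= hitting_time xi r w.
Proof. by apply: le_ereal_inf_tmp => _ [n _ <-]; rewrite lee_fin. Qed.

Lemma measurable_hitting_time r : measurable_fun setT (hitting_time xi r).
Proof.
rewrite (_ : hitting_time xi r = fun w => \sum_(0 <= k <oo) (\1_(A r k.+1) w)%:E).
  apply: ge0_emeasurable_sum => [k w _ _|k _]; first by rewrite lee_fin.
  by apply/measurable_EFinP; exact: measurable_indic.
by apply/funext => w; exact: hitting_timeE.
Qed.

Lemma expectation_hitting_time r :
  \int[P]_w hitting_time xi r w = \sum_(0 <= k <oo) P (A r k.+1).
Proof.
under eq_integral do rewrite hitting_timeE.
rewrite integral_nneseries//; last first.
  by move=> k; apply/measurable_EFinP; exact: measurable_indic.
by apply: eq_eseriesr => k _; rewrite integral_indic// setIT.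
Qed.

(** Each step above r costs e, so e E tau is bounded by the initial budget [V z]. *)
Lemma foster_criterion V (r e : R) : measurable_fun setT V ->
  (forall x, 0 <= V x)%R -> (0 < e)%R ->
  (forall x, above r x -> \int[Ks x]_y (V y)%:E + e%:E <= (V x)%:E) ->
  \int[P]_w hitting_time xi r w < +oo.
Proof.
move=> mV V0 e0 DV.
have mEV : measurable_fun setT (EFin \o V) by exact/measurable_EFinP.
have EV0 x : 0 <= (EFin \o V) x by rewrite lee_fin.
have ce0 (x : half_strip R S) : 0 <= cst e%:E x by rewrite lee_fin ltW.
have H n := supermartingale_region mp (measurable_above r) (filtrationT mp 0)
  mEV EV0 (measurable_cst e%:E) ce0 DV n.
rewrite expectation_hitting_time.
suff : e%:E * \sum_(0 <= k <oo) P (A r k.+1) <= (V z)%:E.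
  move=> Vz; have : e%:E * \sum_(0 <= k <oo) P (A r k.+1) < +oo.
    by apply: le_lt_trans Vz _; exact: ltry.
  by apply: contraTT; rewrite -!leNgt !leye_eq => /eqP ->; rewrite gt0_muley.
rewrite -nneseriesZl//; apply: lime_le.
  by apply: is_cvg_nneseries => k _ _; rewrite mule_ge0// lee_fin ltW.
apply: nearW => n; rewrite big_mkord.
apply: (@le_trans _ _ (\int[P]_(w in setT) (V (xi 0%N w))%:E)); last first.
  under eq_integral do rewrite (mp_initial mp).
  rewrite integral_cst// -[leRHS]mule1; apply: lee_pmul => //.
    by rewrite lee_fin.
  exact: probability_le1.
apply: le_trans (H n); apply: lee_sum => k _.
rewrite -[leLHS]adde0; apply: leeD; first by rewrite integral_cst//; exact: mA.
by apply: integral_ge0 => w _; rewrite lee_fin.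
Qed.

(** If E tau were finite, E W would stay bounded while alive. As V is small compared with W, the
    part of V still alive would vanish as time grows, leaving only exit values, at most v; but the
    submartingale started at [V z] > v. *)
Lemma null_criterion V W (r c v : R) : measurable_fun setT V ->
  (forall x, 0 <= V x)%R -> measurable_fun setT W -> (forall x, 0 <= W x)%R ->
  (forall x, above r x -> (V x)%:E <= \int[Ks x]_y (V y)%:E) ->
  (0 <= c)%R ->
  (forall x, above r x -> \int[Ks x]_y (W y)%:E <= (W x)%:E + c%:E) ->
  (forall a, 0 < a -> exists b, forall x, V x <= a * W x + b)%R ->
  (forall x : half_strip R S, x.1%:num <= r -> V x <= v)%R -> (0 <= v)%R -> (v < V z)%R ->
  \int[P]_w hitting_time xi r w = +oo.
Proof.
move=> mV V0 mW W0 DV c0 DW VW Vv v0 vz; rewrite expectation_hitting_time.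
apply: contrapT => /eqP; rewrite -ltey => Tfin.
have [T TE] : exists T : R, \sum_(0 <= k <oo) P (A r k.+1) = T%:E.
  exists (fine (\sum_(0 <= k <oo) P (A r k.+1))); rewrite fineK// ge0_fin_numE//.
  by apply: nneseries_ge0 => k _ _; exact: measure_ge0.
have sumT n : \sum_(k < n) P (A r k.+1) <= T%:E.
  rewrite -TE -(big_mkord xpredT (fun k => P (A r k.+1))).
  by apply: nneseries_lim_ge => k _ _; exact: measure_ge0.
have T0 : (0 <= T)%R by rewrite -lee_fin; have := sumT 0%N; rewrite big_ord0.
have initial (U : half_strip R S -> R) : (forall x, 0 <= U x)%R ->
    \int[P]_(w in setT) (U (xi 0%N w))%:E = (U z)%:E.
  move=> U0; under eq_integral do rewrite (mp_initial mp).
  rewrite integral_cst// -[RHS]mule1; congr (_ * _); exact: probability_setT.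
have mEV : measurable_fun setT (EFin \o V) by exact/measurable_EFinP.
have EV0 x : 0 <= (EFin \o V) x by rewrite lee_fin.
have mEW : measurable_fun setT (EFin \o W) by exact/measurable_EFinP.
have EW0 x : 0 <= (EFin \o W) x by rewrite lee_fin.
have cc0 (x : half_strip R S) : 0 <= cst c%:E x by rewrite lee_fin.
pose M := (W z + c * T)%R.
have WM n : \int[P]_(w in A r n) (W (xi n w))%:E <= M%:E.
  have := growth_region mp (measurable_above r) (filtrationT mp 0)
    mEW EW0 (measurable_cst c%:E) cc0 DW n.
  rewrite add0n => /le_trans; apply; rewrite [X in X + _](initial W W0) EFinD.
  apply: leeD2l; rewrite EFinM; apply: (@le_trans _ _ (c%:E * \sum_(k < n) P (A r k.+1))).
    rewrite ge0_sume_distrr//; apply: lee_sum => k _.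
    by rewrite integral_cst//; exact: mA.
  by apply: lee_wpmul2l => //; exact: sumT.
(* The events [A r n] decrease in n, so each of the first n terms of the series for E tau is at
   least P(A r n). *)
have PA n : n%:R%:E * P (A r n) <= T%:E.
  apply: le_trans (sumT n); rewrite -[n in n%:R]card_ord -sumr_const -sumEFin.
  rewrite ge0_sume_distrl//; apply: lee_sum => k _; rewrite mul1e.
  apply: le_measure; rewrite ?inE//.
  by move=> w [_ Aw]; split => // j jk; apply: Aw; exact: leq_ltn_trans (ltn_ord k).
have exitsum n : \sum_(k < n) \int[P]_(w in exit_set xi 0 (above r) setT k) (V (xi k w))%:E
    <= v%:E.
  have mE k : measurable (exit_set xi 0 (above r) setT k).
    by apply: (measurable_exit mp); [exact: measurable_above|exact: (filtrationT mp)].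
  apply: (@le_trans _ _ (\sum_(k < n) v%:E *
      P (exit_set xi 0 (above r) setT k))).
    apply: lee_sum => k _; rewrite -integral_cst//; apply: ge0_le_integral => //.
    - by move=> w _; rewrite lee_fin.
    - exact: (measurable_along_process mp).
    - move=> w [_ /negP]; rewrite -leNgt lee_fin => wr; exact: Vv.
  rewrite -ge0_sume_distrr// -[leRHS]mule1; apply: lee_wpmul2l => //.
  rewrite -(big_mkord xpredT (fun k => P (exit_set xi 0 (above r) setT k))).
  apply: le_trans (nneseries_lim_ge n _) _; first by move=> k _ _; exact: measure_ge0.
  rewrite -measure_semi_bigcup//; last 2 first.
  - exact: trivIset_exit.
  - by apply: bigcup_measurable => k _; exact: mE.
  by apply: probability_le1; apply: bigcup_measurable => k _; exact: mE.
(* The part still alive is at most a M + |b| P(A r n). Choosing a, then n, makes each term at most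
   h, so V z - v = 4 h would be at most 2 h. *)
pose h := ((V z - v) / 4)%R; have h0 : (0 < h)%R by rewrite divr_gt0// subr_gt0.
have M0 : (0 <= M)%R by rewrite addr_ge0// mulr_ge0.
pose a := (h / (M + 1))%R; have a0 : (0 < a)%R by rewrite divr_gt0// ltr_wpDl.
have aM : (a * M <= h)%R.
  rewrite /a mulrAC ler_pdivrMr ?ltr_wpDl// ler_pM2l//; lra.
clearbody a; have [b Vb] := VW _ a0.
have bb : (b <= `|b|)%R by exact: ler_norm.
have key n : ((V z)%:E <= (a * M)%:E + `|b|%:E * P (A r n) + v%:E).
  have := submartingale_region mp (measurable_above r) (filtrationT mp 0) mEV EV0 DV n.
  rewrite [X in X <= _](initial V V0) => /le_trans; apply; apply: leeD; last exact: exitsum.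
  apply: (@le_trans _ _ (\int[P]_(w in A r n) ((a * W (xi n w))%:E + `|b|%:E))).
    apply: ge0_le_integral => //.
    - exact: mA.
    - exact: (measurable_along_process mp).
    - apply: emeasurable_funD; last exact: measurable_cst.
      apply: (measurable_along_process mp (V := fun x => a * W x)%R).
      exact: measurable_funM.
    - by move=> w _; rewrite add0n lee_fin; have := Vb (xi n w); lra.
  rewrite ge0_integralD//; last 2 first.
  - by move=> w _; rewrite lee_fin mulr_ge0// ltW.
  - apply: (measurable_along_process mp (V := fun x => a * W x)%R).
    exact: measurable_funM.
  rewrite integral_cst; last exact: mA.
  apply: leeD2r; under eq_integral do rewrite EFinM.
  rewrite ge0_integralZl//; last 3 first.
  - exact: (measurable_along_process mp (V := W)).
  - by move=> w _; rewrite lee_fin.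
  - by rewrite lee_fin ltW.
  by rewrite EFinM; apply: lee_wpmul2l; [rewrite lee_fin ltW|exact: WM].
pose n := (Num.truncn (`|b| * T / h)).+1.
have nb : (`|b| * T <= h * n%:R)%R.
  by rewrite [leRHS]mulrC -ler_pdivrMr//; exact/ltW/truncnS_gt.
have n0 : (0 < n%:R :> R)%R by rewrite ltr0n.
have [pn pnE] : exists pn : R, P (A r n) = pn%:E.
  by exists (fine (P (A r n))); rewrite fineK// fin_num_measure//; exact: mA.
have := PA n; have := key n; rewrite pnE -!EFinM -!EFinD !lee_fin => Vz nT.
have bp : (`|b| * pn <= h)%R.
  rewrite -(ler_pM2r n0); apply: le_trans nb.
  rewrite -mulrA; apply: ler_wpM2l => //; by rewrite mulrC.
have : (V z - v = 4 * h)%R by rewrite /h; field.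
by lra.
Qed.

End hitting_times.

(** * Increments of power functions *)

Section power_expansion.
Context (R : realType).
Implicit Types (a t w D p : R).

(** The mean value theorem raises the order by one. The derivative of a Taylor remainder of (1 +
    t)^a is a times the previous remainder of (1 + t)^(a - 1), so iterating gives the expansions
    below. *)
Lemma taylor_step (f df : R -> R) (C : R) (k : nat) :
  (forall s : R, `|s| <= 1 / 2 -> is_derive s 1 f (df s)) ->
  (forall s : R, `|s| <= 1 / 2 -> `|df s| <= C * `|s| ^+ k) -> f 0 = 0 ->
  forall t, `|t| <= 1 / 2 -> `|f t| <= C * `|t| ^+ k.+1.
Proof.
move=> fdf dfC f0 t t2.
have C0 : 0 <= C.
  have := dfC (1 / 2); rewrite ger0_norm ?divr_ge0// => /(_ (lexx _)) H.
  have := le_trans (normr_ge0 _) H; by rewrite pmulr_lge0// exprn_gt0// divr_gt0.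
suff [c ct ->] : exists2 c, `|c| <= `|t| & f t = df c * t.
  rewrite normrM exprSr mulrA ler_wpM2r//.
  apply: le_trans (dfC _ (le_trans ct t2)) _; rewrite ler_wpM2l//.
  by apply: lerXn2r => //; rewrite nnegrE.
have H (a b : R) : a <= b -> (forall s, s \in `[a, b] -> `|s| <= `|t|) ->
    exists2 c, `|c| <= `|t| & f b - f a = df c * (b - a).
  move=> ab sub.
  have fd s : s \in `[a, b] -> is_derive s 1 f (df s).
    by move=> /sub st; apply: fdf; exact: le_trans st t2.
  have fdi s : s \in `]a, b[ -> is_derive s 1 f (df s).
    by move=> sab; apply: fd; exact: subset_itv_oo_cc.
  have cf : {within `[a, b], continuous f}.
    by apply: derivable_within_continuous => s /fd [].
  have [c cab E] := MVT_segment ab fdi cf.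
  exists c; [exact: sub|exact: E].
have [t0|t0] := leP 0 t.
- have [|c ct E] := H 0 t t0; last by exists c => //; move: E; rewrite f0 !subr0.
  by move=> s; rewrite in_itv/= => /andP[s0 st]; rewrite !ger0_norm.
- have [|c ct E] := H t 0 (ltW t0).
    move=> s; rewrite in_itv/= => /andP[s0 st].
    by rewrite !ler0_norm ?lerN2// ltW.
  by exists c => //; move: E; rewrite f0 !sub0r mulrN => /oppr_inj.
Qed.

Lemma powR_bounded a : exists2 C, 0 <= C &
  forall x : R, 1 / 2 <= x <= 2 -> x `^ a <= C.
Proof.
(* The sum covers both signs of a. *)
exists (2 `^ a + 2 `^ (- a)) => [|x /andP[x1 x2]].
  by rewrite addr_ge0// powR_ge0.
have x0 : 0 < x by lra.
have [a0|a0] := leP 0 a.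
  by rewrite (le_trans (ge0_ler_powR a0 _ _ x2)) ?nnegrE ?(ltW x0)// lerDl powR_ge0.
have a0' : 0 <= - a by rewrite oppr_ge0 ltW.
have -> : x `^ a = (x^-1) `^ (- a).
  by rewrite -(powR_inv1 (ltW x0)) -powRrM mulrN mulN1r opprK.
rewrite (@le_trans _ _ (2 `^ (- a)))// ?lerDr ?powR_ge0//.
apply: ge0_ler_powR; rewrite ?nnegrE ?invr_ge0 ?(ltW x0)//.
by rewrite invf_ple ?posrE//; lra.
Qed.

Lemma is_derive_powR_remainder (a b c s : R) : `|s| <= 1 / 2 ->
  is_derive s (1 : R) (fun t => (1 + t) `^ a - 1 - b * t - c * (t * t))
    (a * (1 + s) `^ (a - 1) - b - c * (2 * s)).
Proof.
rewrite ler_norml => /andP[s1 s2]; have s0 : 0 < 1 + s by lra.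
have h0 : is_derive s (1 : R) (fun t : R => 1 + t) 1.
  exact: (is_derive_eq (is_deriveD (is_derive_cst (1 : R) s 1) (is_derive_id s 1))
    (add0r 1)).
have h1 : is_derive s (1 : R) (fun t => (1 + t) `^ a) (a * (1 + s) `^ (a - 1)).
  have h := is_derive1_comp (f := fun y : R => y `^ a) (g := fun t => 1 + t)
    (x := s) (@is_derive1_powR R a _ s0) h0.
  by apply: (is_derive_eq h); rewrite mulr1.
have h2 := is_deriveB h1 (is_derive_cst (1 : R) s 1).
have h3 := is_deriveB h2 (is_deriveZ b (is_derive_id s 1)).
have h4 := is_deriveB h3
  (is_deriveZ c (is_deriveM (is_derive_id s 1) (is_derive_id s 1))).
by apply: (is_derive_eq h4); rewrite /GRing.scale/=; ring.
Qed.

Lemma taylor_powR0 a : exists2 C, 0 <= C & forall t, `|t| <= 1 / 2 ->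
  `|(1 + t) `^ a - 1| <= C * `|t|.
Proof.
have [B B0 HB] := powR_bounded (a - 1).
exists (`|a| * B) => [|t t2]; first by rewrite mulr_ge0.
have -> : (1 + t) `^ a - 1 = (1 + t) `^ a - 1 - 0 * t - 0 * (t * t) by ring.
rewrite -[X in _ <= _ * X]expr1.
apply: (taylor_step (is_derive_powR_remainder a 0 0)) => //.
- move=> s s2; rewrite expr0 mulr1 mul0r !subr0 normrM ler_wpM2l//.
  rewrite ger0_norm ?powR_ge0//.
  by apply: HB; move: s2; rewrite ler_norml; lra.
- by rewrite addr0 powR1; ring.
Qed.

Lemma taylor_powR1 a : exists2 C, 0 <= C & forall t, `|t| <= 1 / 2 ->
  `|(1 + t) `^ a - 1 - a * t| <= C * `|t| ^+ 2.
Proof.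
have [B B0 HB] := taylor_powR0 (a - 1).
exists (`|a| * B) => [|t t2]; first by rewrite mulr_ge0.
have -> : (1 + t) `^ a - 1 - a * t = (1 + t) `^ a - 1 - a * t - 0 * (t * t) by ring.
apply: (taylor_step (is_derive_powR_remainder a a 0)) => //.
- move=> s s2; rewrite expr1 mul0r subr0 -mulrA.
  have -> : a * (1 + s) `^ (a - 1) - a = a * ((1 + s) `^ (a - 1) - 1) by ring.
  by rewrite normrM ler_wpM2l//; exact: HB.
- by rewrite addr0 powR1; ring.
Qed.

Lemma taylor_powR2 a : exists2 C, 0 <= C & forall t, `|t| <= 1 / 2 ->
  `|(1 + t) `^ a - 1 - a * t - a * (a - 1) / 2 * (t * t)| <= C * `|t| ^+ 3.
Proof.
have [B B0 HB] := taylor_powR1 (a - 1).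
exists (`|a| * B) => [|t t2]; first by rewrite mulr_ge0.
apply: (taylor_step (is_derive_powR_remainder a a (a * (a - 1) / 2))) => //.
- move=> s s2.
  have -> : a * (1 + s) `^ (a - 1) - a - a * (a - 1) / 2 * (2 * s) =
    a * ((1 + s) `^ (a - 1) - 1 - (a - 1) * s) by field.
  by rewrite normrM -mulrA ler_wpM2l//; exact: HB.
- by rewrite addr0 powR1; ring.
Qed.

(** For jumps of relative size at least 1/2, the base c |t| is at least 1, so every lower power is
    absorbed by the p-th. *)
Lemma large_ratio_bound (c p t : R) (j : nat) : 2 <= c -> 1 / 2 <= `|t| ->
  j%:R <= p -> (c * `|t|) ^+ j <= c `^ p * `|t| `^ p.
Proof.
move=> c2 t2 jp; have c0 : 0 <= c by lra.
have ct1 : 1 <= c * `|t| by apply: le_trans (ler_pM _ _ c2 t2) => //; lra.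
have ct0 : 0 <= c * `|t| by lra.
by rewrite -powRM// -powR_mulrn//; exact: ler_powR.
Qed.

Lemma ratio_powR w D p : 1 <= w -> w `^ (- p) * `|D| `^ p = `|D / w| `^ p.
Proof.
move=> w1; have w0 : 0 <= w by lra.
rewrite normrM normfV (ger0_norm w0) powRM ?invr_ge0// mulrC; congr (_ * _).
by rewrite -(powR_inv1 w0) -powRrM mulN1r.
Qed.

(** With D = w t: for |t| <= 1/2 the cubic Taylor error is at most |t|^p because p <= 3; for larger
    |t| each term separately is absorbed because p >= 2. The summand 1 next to w^a is for a < 0,
    where a large downward jump makes (w + D)^a of order 1. *)
Lemma powR_increment2 (a p : R) : a <= 2 -> 2 <= p <= 3 ->
  exists2 C, 0 <= C & forall w D, 1 <= w -> 1 <= w + D ->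
  `|(w + D) `^ a - w `^ a - a * w `^ (a - 1) * D -
    a * (a - 1) / 2 * w `^ (a - 2) * D ^+ 2| <=
  C * ((w `^ a + 1) * w `^ (- p)) * `|D| `^ p.
Proof.
move=> a2 /andP[p2 p3]; have [B B0 HB] := taylor_powR2 a.
pose c := a * (a - 1) / 2.
exists (B + (3 `^ p + (1 + `|a| + `|c|) * 2 `^ p)) => [|w D w1 wD1].
  by rewrite !addr_ge0 ?mulr_ge0 ?addr_ge0 ?powR_ge0.
have w0 : 0 < w by lra.
have wne0 : w != 0 by rewrite gt_eqF.
pose t := D / w; have DE : D = w * t by rewrite /t mulrC divfK.
have wa0 : 0 <= w `^ a by exact: powR_ge0.
have tE := ratio_powR D p w1; rewrite -/t in tE.
rewrite [leRHS](_ : _ = (B + (3 `^ p + (1 + `|a| + `|c|) * 2 `^ p)) *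
  (w `^ a + 1) * `|t| `^ p); last by rewrite -tE /c; ring.
rewrite -/c.
have -> : a * w `^ (a - 1) * D = w `^ a * (a * t).
  rewrite powRB; last by rewrite wne0 implybT.
  by rewrite powRr1 ?(ltW w0)// /t; ring.
have -> : c * w `^ (a - 2) * D ^+ 2 = w `^ a * (c * (t * t)).
  rewrite powRB; last by rewrite wne0 implybT.
  by rewrite (powR_mulrn 2) ?(ltW w0)// /t; field.
have tp0 : 0 <= `|t| `^ p by exact: powR_ge0.
have [t2|/ltW t2] := leP `|t| (1 / 2).
- have t1 : 0 <= 1 + t by move: t2; rewrite ler_norml; lra.
  have -> : (w + D) `^ a = w `^ a * (1 + t) `^ a.
    by rewrite -powRM ?(ltW w0)// DE; congr (_ `^ _); ring.
  have -> : w `^ a * (1 + t) `^ a - w `^ a - w `^ a * (a * t) - w `^ a * (c * (t * t)) =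
     w `^ a * ((1 + t) `^ a - 1 - a * t - c * (t * t)) by ring.
  rewrite normrM (ger0_norm wa0).
  have H := HB t t2.
  have t3 : `|t| ^+ 3 <= `|t| `^ p.
    have [t00|t00] := eqVneq t 0; first by rewrite t00 normr0 expr0n powR_ge0.
    rewrite -powR_mulrn//; apply: ger_powR => //.
    by rewrite normr_gt0 t00/=; lra.
  apply: (@le_trans _ _ (w `^ a * (B * `|t| `^ p))).
    by apply: ler_wpM2l => //; apply: le_trans H _; exact: ler_wpM2l.
  rewrite mulrA [w `^ a * B]mulrC; apply: ler_wpM2r => //.
  apply: ler_pM => //; last by rewrite lerDl.
  by rewrite lerDl !addr_ge0 ?mulr_ge0 ?addr_ge0 ?powR_ge0.
- have r0 : 1 <= 2 `^ p * `|t| `^ p.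
    by have := @large_ratio_bound 2 p t 0 (lexx _) t2; rewrite expr0; apply; lra.
  have r1 : `|t| <= 2 `^ p * `|t| `^ p.
    by have := @large_ratio_bound 2 p t 1 (lexx _) t2; rewrite expr1; lra.
  have r2 : `|t * t| <= 2 `^ p * `|t| `^ p.
    have := @large_ratio_bound 2 p t 2 (lexx _) t2 p2; apply: le_trans.
    by rewrite normrM exprMn -expr2 ler_peMl// ?sqr_ge0//; lra.
  set T := 2 `^ p * `|t| `^ p in r0 r1 r2.
  (* For a <= 0 the left side is at most 1; for a > 0, |t| >= 1/2 gives 1 + t <= 3 |t|. *)
  have r3 : (w + D) `^ a <= (w `^ a + 1) * (3 `^ p * `|t| `^ p).
    have T3 : 1 <= 3 `^ p * `|t| `^ p.
      by have := @large_ratio_bound 3 p t 0 _ t2; rewrite expr0; apply; lra.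
    have [a0|a0] := leP a 0.
      apply: (@le_trans _ _ 1); first by rewrite -(powRr0 (w + D)); exact: ler_powR.
      by apply: le_trans T3 _; rewrite ler_peMl ?lerDr//; lra.
    have t30 : 0 <= 3 * `|t| by rewrite mulr_ge0.
    have le3 : w + D <= w * (3 * `|t|).
      have -> : w + D = w * (1 + t) by rewrite DE; ring.
      by rewrite ler_wpM2l ?(ltW w0)//; have := ler_norm t; lra.
    apply: (@le_trans _ _ ((w * (3 * `|t|)) `^ a)).
      by apply: ge0_ler_powR; rewrite ?nnegrE ?(ltW a0) ?mulr_ge0 ?(ltW w0)//; lra.
    rewrite powRM ?(ltW w0)//; apply: ler_pM; rewrite ?powR_ge0 ?lerDl//.
    rewrite -powRM//; apply: ler_powR; [lra|lra].
  apply: (@le_trans _ _ ((w + D) `^ a + w `^ a * (1 + `|a| * `|t| + `|c| * `|t * t|))).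
    have wD0 : 0 <= (w + D) `^ a by exact: powR_ge0.
    have -> : (w + D) `^ a - w `^ a - w `^ a * (a * t) - w `^ a * (c * (t * t)) =
      (w + D) `^ a + w `^ a * (- (1 + a * t + c * (t * t))) by ring.
    apply: le_trans (ler_normD _ _) _; rewrite (ger0_norm wD0) lerD2l normrM.
    rewrite (ger0_norm wa0) ler_wpM2l// normrN.
    apply: le_trans (ler_normD _ _) _; apply: lerD; last by rewrite normrM.
    by apply: le_trans (ler_normD _ _) _; rewrite normr1 normrM.
  apply: (@le_trans _ _ ((w `^ a + 1) * (3 `^ p * `|t| `^ p) +
    (w `^ a + 1) * ((1 + `|a| + `|c|) * T))).
    apply: lerD => //; apply: ler_pM => //.
    - by rewrite lerDl.
    - rewrite !mulrDl mul1r; apply: lerD; [apply: lerD => //|]; exact: ler_wpM2l.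
  rewrite /T; set Y := `|t| `^ p; set Z := w `^ a + 1; set U := 2 `^ p; set V := 3 `^ p.
  have -> : (B + (V + (1 + `|a| + `|c|) * U)) * Z * Y =
    B * Z * Y + (Z * (V * Y) + Z * ((1 + `|a| + `|c|) * (U * Y))) by ring.
  by rewrite lerDr !mulr_ge0// /Z addr_ge0.
Qed.

(** Meant for the factor (1 + x)^(a - 2) of the corrector. As b <= 0, both powers lie in [0, 1],
    which settles large jumps. *)
Lemma powR_increment0 (b p : R) : b <= 0 -> 2 <= p ->
  exists2 C, 0 <= C & forall w D, 1 <= w -> 1 <= w + D ->
  `|(w + D) `^ b - w `^ b| <=
  C * (w `^ (b - 1) * `|D| + w `^ (- p) * `|D| `^ p).
Proof.
move=> b0 p2; have [B B0 HB] := taylor_powR0 b.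
exists (B + 2 `^ p) => [|w D w1 wD1]; first by rewrite addr_ge0 ?powR_ge0.
have w0 : 0 < w by lra.
have wne0 : w != 0 by rewrite gt_eqF.
pose t := D / w; have DE : D = w * t by rewrite /t mulrC divfK.
have wb0 : 0 <= w `^ b by exact: powR_ge0.
have tp0 : 0 <= `|t| `^ p by exact: powR_ge0.
rewrite ratio_powR// -/t.
have -> : w `^ (b - 1) * `|D| = w `^ b * `|t|.
  rewrite powRB; last by rewrite wne0 implybT.
  by rewrite powRr1 ?(ltW w0)// /t normrM normfV (gtr0_norm w0); ring.
have [t2|/ltW t2] := leP `|t| (1 / 2).
- have t1 : 0 <= 1 + t by move: t2; rewrite ler_norml; lra.
  have -> : (w + D) `^ b = w `^ b * (1 + t) `^ b.
    by rewrite -powRM ?(ltW w0)// DE; congr (_ `^ _); ring.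
  have -> : w `^ b * (1 + t) `^ b - w `^ b = w `^ b * ((1 + t) `^ b - 1) by ring.
  rewrite normrM (ger0_norm wb0).
  apply: (@le_trans _ _ (w `^ b * (B * `|t|))).
    by apply: ler_wpM2l => //; exact: HB.
  rewrite mulrCA; apply: ler_pM; rewrite ?mulr_ge0 ?lerDl ?powR_ge0//.
- have r0 : 1 <= 2 `^ p * `|t| `^ p.
    by have := @large_ratio_bound 2 p t 0 (lexx _) t2; rewrite expr0; apply; lra.
  have le1 x : 1 <= x -> x `^ b <= 1 by move=> x1; rewrite -(powRr0 x); exact: ler_powR.
  apply: (@le_trans _ _ 1).
    have := le1 _ w1; have := le1 _ wD1; have := powR_ge0 (w + D) b.
    by rewrite ler_norml; lra.
  apply: le_trans r0 _; apply: ler_pM; rewrite ?powR_ge0 ?lerDr//.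
  by rewrite mulr_ge0.
Qed.

End power_expansion.

(** * Drift of the Lyapunov functions *)

Lemma powRN_small (R : realType) (s e : R) : 0 < s -> 0 < e ->
  exists r, forall w, r < w -> w `^ (- s) <= e.
Proof.
move=> s0 e0; exists (e `^ (- s^-1)) => w rw.
have w0 : 0 < w by apply: le_lt_trans rw; exact: powR_ge0.
rewrite powRN invf_ple ?posrE ?powR_gt0//.
have -> : e^-1 = (e `^ (- s^-1)) `^ s.
  by rewrite -powRrM mulNr mulVf ?gt_eqF// powR_inv1// ltW.
by apply: ge0_ler_powR; rewrite ?nnegrE ?powR_ge0 ?(ltW w0) ?(ltW s0)// ltW.
Qed.

Section limits.
Context (R : realType) (d : measure_display) (S : borelMetricType d R).
Hypothesis compactS : compact [set: S].
Context (Ks : R.-pker (half_strip R S) ~> (half_strip R S)) (K : R.-pker S ~> S).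
Implicit Type z : half_strip R S.

Lemma cvg0_pinfty (X : R -> \bar R) (e : R) :
  X x @[x --> +oo%R] --> 0%E -> 0 < e ->
  exists r, forall x, r < x -> (X x < e%:E)%E.
Proof.
by move=> X0 e0; have [r [_ rX]] := cvge0_lt _ X0 e0; exists r.
Qed.

Lemma hlE z : hl z.1%:num = z.1.
Proof. by apply/val_inj => /=; rewrite ger0_norm. Qed.

Lemma measurable_snd_fun (g : S -> R) : measurable_fun setT g ->
  measurable_fun setT (fun y : half_strip R S => g y.2).
Proof. by move=> mg; apply: measurableT_comp => //; exact: measurable_snd. Qed.

Lemma bounded_measurable_snd (g : S -> R) : bounded_measurable g ->
  bounded_measurable (fun y : half_strip R S => g y.2).
Proof.
by move=> [mg [M gM]]; split; [exact: measurable_snd_fun|exists M].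
Qed.

Lemma integral_marginal x u (g : S -> R) : bounded_measurable g ->
  (\int[marginal_kernel Ks x u]_v (g v)%:E)%E = (kop Ks (fun y => g y.2) (x, u))%:E.
Proof.
move=> bg; rewrite EFin_kop; last exact: bounded_measurable_snd.
rewrite (_ : marginal_kernel Ks x u = pushforward (Ks (x, u)) snd); last first.
  apply/funext => B; rewrite /marginal_kernel /pushforward; congr (Ks (x, u) _).
  by apply/seteqP; split => [y []|y].
have [mg _] := bg.
have ig : (Ks (x, u)).-integrable (snd @^-1` setT) ((EFin \o g) \o snd).
  apply: bounded_measurable_integrable; first exact: prob_kernel.
  exact: bounded_measurable_snd.
by rewrite (integral_pushforward measurable_snd _ ig)//; exact/measurable_EFinP.
Qed.

(** Allows K to replace the true transition of eta in the drift of the corrector; [c] rescales g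
    into the unit ball of test functions. *)
Lemma kop_marginal_limit (g : S -> R) (e : R) : asymptotically_markov Ks K ->
  continuous g -> 0 < e -> exists r, forall z, r < z.1%:num ->
  `|kop Ks (fun y => g y.2) z - kop K g z.2| <= e.
Proof.
move=> asym cg e0; have bg := continuous_bounded_measurable compactS cg.
have [_ [M gM]] := bg.
pose c := (`|M| + 1)^-1.
have c0 : 0 < c by rewrite invr_gt0 ltr_wpDl.
have gc x : `|c * g x| <= 1.
  rewrite normrM gtr0_norm// /c mulrC ler_pdivrMr ?ltr_wpDl// mul1r.
  by apply: le_trans (gM x) _; apply: le_trans (ler_norm M) _; rewrite lerDl.
have ce0 : 0 < c * e by rewrite mulr_gt0.
have [r rP] := cvg0_pinfty asym ce0; exists r => z rz.
have key (f : S -> R) : continuous f -> (forall x, `|f x| <= 1) ->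
    kop Ks (fun y => f y.2) z - kop K f z.2 <= c * e.
  move=> cf f1; have bf := continuous_bounded_measurable compactS cf.
  rewrite -lee_fin; apply: le_trans (ltW (rP _ rz)).
  have E : (kop Ks (fun y => f y.2) z)%:E =
      (\int[marginal_kernel Ks z.1 z.2]_v (f v)%:E)%E.
    by rewrite integral_marginal// -surjective_pairing.
  rewrite EFinB E EFin_kop//.
  apply: le_trans (tv_norm_sub_ge _ _ cf f1) _.
  by apply: ereal_sup_ubound; exists z.2 => //; rewrite hlE.
have cgc (b : R) : continuous (fun x => b * g x) by move=> x; apply: cvgMr; exact: cg.
have H1 := key _ (cgc c) gc.
have H2 := key _ (cgc (- c)).
have bg2 := bounded_measurable_snd bg.
rewrite !(meanZ (mean_kop _ _))// -mulrBr ler_pM2l// in H1.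
rewrite !(meanZ (mean_kop _ _))// -mulrBr mulNr -mulrN ler_pM2l// in H2.
rewrite ler_norml H1 andbT lerNl; apply: H2.
by move=> x; rewrite mulNr normrN.
Qed.

Section moments.
Context (p xB B : R) (p_gt2 : 2 < p).
Hypothesis moment : forall z, xB <= z.1%:num ->
  (\int[Ks z]_y (`|y.1%:num - z.1%:num| `^ p)%:E <= B%:E)%E.

Lemma measurable_increment z :
  measurable_fun setT (fun y : half_strip R S => y.1%:num - z.1%:num : R).
Proof. by apply: measurable_funB => //; exact: measurable_radius. Qed.

Lemma measurable_increment_powR z : measurable_fun setT
  (fun y : half_strip R S => `|y.1%:num - z.1%:num| `^ p : R).
Proof.
apply: (measurableT_comp (f := fun x : R => x `^ p)); first exact: measurable_powR.
by apply: measurableT_comp => //; exact: measurable_increment.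
Qed.

Lemma integrable_increment_powR z : xB <= z.1%:num ->
  (Ks z).-integrable setT (EFin \o (fun y : half_strip R S => `|y.1%:num - z.1%:num| `^ p : R)).
Proof.
move=> zB; apply/integrableP; split.
  by apply/measurable_EFinP; exact: measurable_increment_powR.
under eq_integral do rewrite /= ger0_norm ?powR_ge0//.
by apply: le_lt_trans (moment zB) _; rewrite ltry.
Qed.

Lemma kop_increment_powR z : xB <= z.1%:num ->
  kop Ks (fun y => `|y.1%:num - z.1%:num| `^ p) z <= B.
Proof.
move=> zB; rewrite -lee_fin /kop /Rintegral fineK; first exact: moment.
by apply: integrable_fin_num => //; exact: integrable_increment_powR.
Qed.

Lemma integrable_cst z (c : R) : (Ks z).-integrable setT (EFin \o (fun=> c)).
Proof.
apply: bounded_measurable_integrable; first exact: prob_kernel.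
exact: bounded_measurable_cst.
Qed.

Lemma integrable_increment z k : (k <= 2)%N -> xB <= z.1%:num ->
  (Ks z).-integrable setT (EFin \o (fun y : half_strip R S => (y.1%:num - z.1%:num) ^+ k : R)).
Proof.
move=> k2 zB.
apply: (@le_integrable _ _ _ _ _ measurableT _
  (EFin \o (fun y : half_strip R S => 1 + `|y.1%:num - z.1%:num| `^ p : R))).
- apply/measurable_EFinP; apply: measurable_funX; exact: measurable_increment.
- move=> y _; rewrite /= lee_fin [leRHS]ger0_norm ?addr_ge0 ?powR_ge0// normrX.
  set D := `|_|; have D0 : 0 <= D by exact: normr_ge0.
  have [D1|D1] := leP D 1.
    by apply: (@le_trans _ _ 1); [exact: exprn_ile1|rewrite lerDl powR_ge0].
  apply: (@le_trans _ _ (D `^ p)); last by rewrite lerDr.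
  rewrite -powR_mulrn//; apply: ler_powR; first exact: ltW.
  by apply: le_trans (ltW p_gt2); rewrite ler_nat.
- have -> : EFin \o (fun y : half_strip R S => 1 + `|y.1%:num - z.1%:num| `^ p) =
    ((EFin \o (fun=> 1%R)) \+
       (EFin \o (fun y : half_strip R S => (`|y.1%:num - z.1%:num| `^ p)%R)))%E by [].
  apply: integrableD => //; first exact: integrable_cst.
  exact: integrable_increment_powR.
Qed.

Lemma increment_momentE z k : (k <= 2)%N -> xB <= z.1%:num ->
  increment_moment Ks k z.1 z.2 = (kop Ks (fun y => (y.1%:num - z.1%:num) ^+ k) z)%:E.
Proof.
case: z => x u k2 zB; rewrite /kop /Rintegral fineK//.
by apply: integrable_fin_num => //; exact: integrable_increment.
Qed.

Lemma kop_norm_increment z : xB <= z.1%:num ->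
  kop Ks (fun y => `|y.1%:num - z.1%:num|) z <= 1 + B.
Proof.
move=> zB; have i1 := integrable_increment (isT : (1 <= 2)%N) zB.
apply: (@le_trans _ _ (kop Ks (fun y => 1 + `|y.1%:num - z.1%:num| `^ p) z)).
  apply: le_Rintegral => //.
  - by have := integrable_norm i1; apply: eq_integrable => // y _ /=; rewrite expr1.
  - have -> : EFin \o (fun y : half_strip R S => 1 + `|y.1%:num - z.1%:num| `^ p) =
      ((EFin \o (fun=> 1%R)) \+
       (EFin \o (fun y : half_strip R S => (`|y.1%:num - z.1%:num| `^ p)%R)))%E by [].
    apply: integrableD => //; first exact: integrable_cst.
    exact: integrable_increment_powR.
  - move=> y _; set D := `|_|; have D0 : 0 <= D by exact: normr_ge0.
    have [D1|D1] := leP D 1; first by rewrite (le_trans D1)// lerDl powR_ge0.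
    apply: (@le_trans _ _ (D `^ p)); last by rewrite lerDr.
    apply: (@le_trans _ _ (D `^ 1)); first by rewrite powRr1.
    apply: ler_powR; first exact: ltW.
    by apply: le_trans (ltW p_gt2); rewrite ler1n.
rewrite /kop RintegralD//; last 2 first.
- exact: integrable_cst.
- exact: integrable_increment_powR.
rewrite Rintegral_cst// prob_kernel mul1r lerD2l; exact: kop_increment_powR.
Qed.

Lemma moment_limits (e sigma2 : S -> R) (eps : R) : strict_lamperti Ks e sigma2 ->
  (exists M, forall u, `|e u| <= M) -> 0 < eps ->
  exists r, forall z, r < z.1%:num ->
  `|(1 + z.1%:num) * kop Ks (fun y => y.1%:num - z.1%:num) z - e z.2| <= eps /\
  `|kop Ks (fun y => (y.1%:num - z.1%:num) ^+ 2) z - sigma2 z.2| <= eps.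
Proof.
move=> [H1 H2] [M eM] eps0; have e20 : 0 < eps / 2 by rewrite divr_gt0.
have [r1 r1P] := cvg0_pinfty H1 e20; have [r2 r2P] := cvg0_pinfty H2 eps0.
(* The hypothesis multiplies by x, the Lyapunov function by 1 + x; the difference is the mean
   increment m itself, at most (|M| + eps) / x, hence at most eps / 2 beyond [r3]. *)
pose r3 := (`|M| + eps) / (eps / 2).
exists (Num.max (Num.max r1 r2) (Num.max (Num.max 1 r3) xB)) => z.
rewrite !gt_max -!andbA => /and5P[z1 z2 z3 z4 z5].
have zB : xB <= z.1%:num by exact: ltW.
have z0 : 0 < z.1%:num :> R by exact: lt_trans z3.
split; last first.
  rewrite -lee_fin; apply: le_trans (ltW (r2P _ z2)); apply: ereal_sup_ubound.
  by exists z.2 => //; rewrite hlE increment_momentE.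
set m := kop _ _ _.
have mE : increment_moment Ks 1 z.1 z.2 = m%:E.
  by rewrite increment_momentE//; congr EFin; apply: eq_Rintegral => y _; rewrite expr1.
have zm : `|z.1%:num * m - e z.2| <= eps / 2.
  have -> : z.1%:num * m - e z.2 = z.1%:num * (m - e z.2 / z.1%:num).
    by rewrite mulrBr [_ * (_ / _)]mulrC divfK// gt_eqF.
  rewrite normrM gtr0_norm// -lee_fin EFinM; apply: le_trans (ltW (r1P _ z1)).
  apply: lee_wpmul2l; first by rewrite lee_fin ltW.
  by apply: ereal_sup_ubound; exists z.2 => //; rewrite hlE mE.
have mM : `|m| <= eps / 2.
  rewrite -(ler_pM2l z0) -[X in X * `|m|](gtr0_norm z0) -normrM.
  apply: (@le_trans _ _ (`|M| + eps)); last first.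
    by rewrite -ler_pdivrMr//; exact: ltW.
  have := le_trans (eM z.2) (ler_norm M); move: zm; rewrite !ler_norml; lra.
have -> : (1 + z.1%:num) * m - e z.2 = m + (z.1%:num * m - e z.2) by ring.
by apply: le_trans (ler_normD _ _) _; rewrite (splitr eps) lerD.
Qed.

End moments.
End limits.

Section lyapunov.
Context (R : realType) (d : measure_display) (S : borelMetricType d R).
Implicit Types (z y : half_strip R S) (a : R) (g : S -> R).

(** The shift by 1 keeps the base at least 1 down to x = 0, so nonpositive powers stay bounded. *)
Definition lyapunov a g (z : half_strip R S) : R :=
  (1 + z.1%:num) `^ a + (1 + z.1%:num) `^ (a - 2) * g z.2.

Lemma radius_ge1 z : 1 <= 1 + z.1%:num :> R. Proof. by rewrite lerDl. Qed.

Lemma lyapunov_ge a g z : (forall u, 0 <= g u) ->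
  (1 + z.1%:num) `^ a <= lyapunov a g z.
Proof. by move=> g0; rewrite lerDl mulr_ge0 ?powR_ge0. Qed.

Lemma lyapunov_ge0 a g z : (forall u, 0 <= g u) -> 0 <= lyapunov a g z.
Proof. by move=> g0; apply: le_trans (lyapunov_ge a z g0); exact: powR_ge0. Qed.

Lemma measurable_radius_powR a :
  measurable_fun setT (fun z : half_strip R S => (1 + z.1%:num) `^ a : R).
Proof.
apply: (measurableT_comp (f := fun x : R => x `^ a)); first exact: measurable_powR.
by apply: measurable_funD => //; exact: measurable_radius.
Qed.

Lemma measurable_lyapunov a g : continuous g -> measurable_fun setT (lyapunov a g).
Proof.
move=> cg; apply: measurable_funD; first exact: measurable_radius_powR.
apply: measurable_funM; first exact: measurable_radius_powR.
by apply: measurable_snd_fun; exact: continuous_measurable.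
Qed.

Lemma lyapunov_le a g M z : a <= 2 -> (forall u, 0 <= g u <= M) ->
  lyapunov a g z <= (1 + z.1%:num) `^ a + M.
Proof.
move=> a2 gM; have /andP[g0 g1] := gM z.2.
rewrite lerD2l; apply: (@le_trans _ _ (1 * g z.2)); last by rewrite mul1r.
rewrite ler_wpM2r// -[leRHS](powRr0 (1 + z.1%:num)).
by apply: ler_powR; [exact: radius_ge1|lra].
Qed.

Section drift.
Hypothesis compactS : compact [set: S].
Context (Ks : R.-pker (half_strip R S) ~> (half_strip R S)) (K : R.-pker S ~> S).
Context (p xB B : R) (p_gt2 : 2 < p) (p_le3 : p <= 3) (B_ge0 : 0 <= B).
Hypothesis moment : forall z, xB <= z.1%:num ->
  (\int[Ks z]_y (`|y.1%:num - z.1%:num| `^ p)%:E <= B%:E)%E.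

Let D z y : R := y.1%:num - z.1%:num.
Let w z : R := 1 + z.1%:num.

Let remainder a g z y : R := lyapunov a g y - lyapunov a g z -
  a * w z `^ (a - 1) * D z y - a * (a - 1) / 2 * w z `^ (a - 2) * D z y ^+ 2 -
  w z `^ (a - 2) * (g y.2 - g z.2).

(** The corrector's increment splits into a change of g with the power frozen, which is a main term,
    and g at the new state times a change of the power, which is an error. *)
Let remainder_le a g : a <= 2 -> continuous g -> exists2 C, 0 <= C &
  forall z y, `|remainder a g z y| <=
    C * ((w z `^ a + 1) * w z `^ (- p)) * `|D z y| `^ p + C * w z `^ (a - 3) * `|D z y|.
Proof.
move=> a2 cg; have [_ [G gG]] := continuous_bounded_measurable compactS cg.
have p23 : 2 <= p <= 3 by rewrite (ltW p_gt2).
have [C1 C10 H1] := powR_increment2 a2 p23.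
have b0 : a - 2 <= 0 by lra.
have [C0 C00 H0] := powR_increment0 b0 (ltW p_gt2).
exists (C1 + `|G| * C0) => [|z y]; first by rewrite addr_ge0// mulr_ge0.
have wD : 1 <= w z + D z y by rewrite /w /D; have := radius_ge1 y; lra.
have {}H1 := H1 _ _ (radius_ge1 z) wD.
have {}H0 := H0 _ _ (radius_ge1 z) wD.
have yE : 1 + y.1%:num = w z + D z y by rewrite /w /D; ring.
set T1 := (_ - _) in H1.
set T0 := (_ - _) in H0.
have -> : remainder a g z y = T1 + g y.2 * T0.
  by rewrite /remainder /lyapunov /T1 /T0 yE -/(w z); ring.
rewrite -/(w z) in H1 H0.
have gyG : `|g y.2| <= `|G| by exact: le_trans (gG _) (ler_norm _).
apply: le_trans (ler_normD _ _) _; rewrite normrM.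
apply: le_trans (lerD H1 (ler_pM (normr_ge0 _) (normr_ge0 _) gyG H0)) _.
have -> : a - 2 - 1 = a - 3 by ring.
set X := `|D z y|; set Xp := X `^ p; set wa := w z `^ a; set wp := w z `^ (- p).
set wb := w z `^ (a - 3).
have X0 : 0 <= X by exact: normr_ge0.
have Xp0 : 0 <= Xp by exact: powR_ge0.
have wa0 : 0 <= wa by exact: powR_ge0.
have wp0 : 0 <= wp by exact: powR_ge0.
have wb0 : 0 <= wb by exact: powR_ge0.
have h1 : 0 <= `|G| * C0 * (wa * wp * Xp) by rewrite !mulr_ge0.
have h2 : 0 <= C1 * (wb * X) by rewrite !mulr_ge0.
rewrite -subr_ge0.
have -> : (C1 + `|G| * C0) * ((wa + 1) * wp) * Xp + (C1 + `|G| * C0) * wb * X -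
   (C1 * ((wa + 1) * wp) * Xp + `|G| * (C0 * (wb * X + wp * Xp))) =
   `|G| * C0 * (wa * wp * Xp) + C1 * (wb * X) by ring.
exact: addr_ge0.
Qed.

Lemma lyapunov_increment a g : a <= 2 -> continuous g -> exists2 C, 0 <= C &
  forall z, xB <= z.1%:num ->
  (Ks z).-integrable setT (EFin \o lyapunov a g) /\
  `|kop Ks (lyapunov a g) z - lyapunov a g z -
    (a * w z `^ (a - 1) * kop Ks (D z) z +
     a * (a - 1) / 2 * w z `^ (a - 2) * kop Ks (fun y => D z y ^+ 2) z +
     w z `^ (a - 2) * (kop Ks (fun y => g y.2) z - g z.2))| <=
  C * ((w z `^ a + 1) * w z `^ (- p) + w z `^ (a - 3)).
Proof.
move=> a2 cg; have [C C0 HC] := remainder_le a2 cg.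
(* 1 + B bounds both E |D|^p and E |D|. *)
exists (C * (1 + B)) => [|z zB]; first by rewrite mulr_ge0// addr_ge0.
have bg := bounded_measurable_snd (continuous_bounded_measurable compactS cg).
have icst c : (Ks z).-integrable setT (EFin \o (fun=> c : R)) by exact: integrable_cst.
have iD1 : (Ks z).-integrable setT (EFin \o D z).
  have := integrable_increment p_gt2 moment (isT : (1 <= 2)%N) zB.
  by apply: eq_integrable => // y _ /=; rewrite expr1.
have iD2 : (Ks z).-integrable setT (EFin \o (fun y => D z y ^+ 2)).
  exact: (integrable_increment p_gt2 moment (isT : (2 <= 2)%N) zB).
have ig : (Ks z).-integrable setT (EFin \o (fun y : half_strip R S => g y.2)).
  by apply: bounded_measurable_integrable => //; exact: prob_kernel.
have iDp := integrable_increment_powR moment zB.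
have iaD : (Ks z).-integrable setT (EFin \o (fun y => `|D z y|)).
  exact: integrable_norm iD1.
have iZ c f : (Ks z).-integrable setT (EFin \o f) ->
    (Ks z).-integrable setT (EFin \o (fun y => c * f y : R)).
  move=> i; have -> : EFin \o (fun y => c * f y) = (fun y => c%:E * (EFin \o f) y)%E.
    by apply/funext => y; rewrite /= EFinM.
  exact: integrableZl.
have iDD f h : (Ks z).-integrable setT (EFin \o f) ->
    (Ks z).-integrable setT (EFin \o h) ->
    (Ks z).-integrable setT (EFin \o (fun y => f y + h y : R)).
  by move=> i j; have := integrableD measurableT i j; apply: eq_integrable.
set c1 := a * w z `^ (a - 1); set c2 := a * (a - 1) / 2 * w z `^ (a - 2).
set c3 := w z `^ (a - 2).
set bd := fun y => C * ((w z `^ a + 1) * w z `^ (- p)) * `|D z y| `^ p +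
  C * w z `^ (a - 3) * `|D z y|.
have ibd : (Ks z).-integrable setT (EFin \o bd) by apply: iDD; exact: iZ.
pose lin y := lyapunov a g z + (c1 * D z y + (c2 * D z y ^+ 2 + c3 * (g y.2 - g z.2))).
have igg : (Ks z).-integrable setT (EFin \o (fun y : half_strip R S => g y.2 - g z.2)).
  by have := iDD _ _ ig (icst (- g z.2)).
have i3 := iZ c3 _ igg.
have i2 := iZ c2 _ iD2.
have i1 := iZ c1 _ iD1.
have i23 := iDD _ _ i2 i3.
have i123 := iDD _ _ i1 i23.
have ilin : (Ks z).-integrable setT (EFin \o lin) by exact: iDD.
have remE y : remainder a g z y = lyapunov a g y - lin y.
  by rewrite /remainder /lin /c1 /c2 /c3; ring.
(* Integrability of the Lyapunov function is deduced from that of the dominated remainder and of the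
   main part [lin]. *)
have irem : (Ks z).-integrable setT (EFin \o remainder a g z).
  apply: le_integrable ibd => //.
    apply/measurable_EFinP.
    rewrite (_ : remainder a g z = fun y => lyapunov a g y - lin y); last exact/funext.
    apply: measurable_funB; first exact: measurable_lyapunov.
    by apply/measurable_EFinP; case/integrableP: ilin.
  move=> y _; rewrite /= lee_fin; apply: le_trans (HC z y) _; exact: ler_norm.
have VE : lyapunov a g = fun y => remainder a g z y + lin y.
  by apply/funext => y; rewrite remE subrK.
have iV : (Ks z).-integrable setT (EFin \o lyapunov a g) by rewrite VE; exact: iDD.
split => //.
have linE : kop Ks lin z = lyapunov a g z + (c1 * kop Ks (D z) z +
    (c2 * kop Ks (fun y => D z y ^+ 2) z + c3 * (kop Ks (fun y => g y.2) z - g z.2))).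
  rewrite /kop RintegralD// Rintegral_cst// prob_kernel mulr1; congr (_ + _).
  rewrite RintegralD// RintegralZl//; congr (_ + _).
  rewrite RintegralD// RintegralZl//; congr (_ + _).
  rewrite RintegralZl//; congr (_ * _).
  rewrite (RintegralB measurableT ig (icst (g z.2))).
  by rewrite Rintegral_cst// prob_kernel mulr1.
have -> : kop Ks (lyapunov a g) z - lyapunov a g z - (c1 * kop Ks (D z) z +
    c2 * kop Ks (fun y => D z y ^+ 2) z + c3 * (kop Ks (fun y => g y.2) z - g z.2)) =
    kop Ks (remainder a g z) z.
  have -> : kop Ks (lyapunov a g) z = kop Ks (remainder a g z) z + kop Ks lin z.
    by rewrite {1}VE /kop RintegralD.
  by rewrite linE; ring.
apply: (@le_trans _ _ (kop Ks bd z)).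
  apply: le_trans (le_normr_Rintegral measurableT irem) _.
  by apply: le_Rintegral => //; exact: integrable_norm irem.
rewrite /kop RintegralD//; [|exact: iZ|exact: iZ].
rewrite !RintegralZl//.
have k1 := kop_increment_powR moment zB.
have k2 := kop_norm_increment p_gt2 moment zB.
rewrite -/(D z) in k1 k2.
set X1 := w z `^ a + 1; set X2 := w z `^ (- p); set X3 := w z `^ (a - 3).
have X10 : 0 <= X1 by rewrite addr_ge0 ?powR_ge0.
have X20 : 0 <= X2 by exact: powR_ge0.
have X30 : 0 <= X3 by exact: powR_ge0.
have -> : C * (1 + B) * (X1 * X2 + X3) =
  C * (X1 * X2) * (1 + B) + C * X3 * (1 + B) by ring.
apply: lerD; apply: ler_wpM2l; rewrite ?mulr_ge0//.
by apply: le_trans k1 _; rewrite lerDr.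
Qed.

End drift.
End lyapunov.

Section asymptotic_drift.
Context (R : realType) (d : measure_display) (S : borelMetricType d R).
Hypothesis compactS : compact [set: S].
Context (Ks : R.-pker (half_strip R S) ~> (half_strip R S)) (K : R.-pker S ~> S)
  (pi : probability S R).
Hypotheses (pi_invariant : unique_invariant_probability K pi)
  (K_continuous : tv_continuous K) (Ks_asymptotic : asymptotically_markov Ks K).
Context (p xB B : R) (p_gt2 : 2 < p) (p_le3 : p <= 3) (B_ge0 : 0 <= B).
Hypothesis moment : forall z : half_strip R S, xB <= z.1%:num ->
  (\int[Ks z]_y (`|y.1%:num - z.1%:num| `^ p)%:E <= B%:E)%E.
Context (e sigma2 : S -> R).
Hypotheses (e_continuous : continuous e) (sigma2_continuous : continuous sigma2)
  (Ks_lamperti : strict_lamperti Ks e sigma2).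
Implicit Type z : half_strip R S.

Let integrand_continuous (c : R) : continuous (fun u => 2 * e u + c * sigma2 u).
Proof.
move=> u; apply: cvgD; apply: cvgMr.
  exact: e_continuous.
exact: sigma2_continuous.
Qed.

Lemma delta_affine theta theta' : delta pi e sigma2 theta' =
  delta pi e sigma2 theta + 2 * (theta' - theta) * \int[pi]_u sigma2 u.
Proof.
have piM : mean (fun f => \int[pi]_u f u) by apply: mean_Rintegral; exact: probability_setT.
have be := continuous_bounded_measurable compactS e_continuous.
have bs := continuous_bounded_measurable compactS sigma2_continuous.
rewrite /delta !(meanD piM) ?(meanZ piM)//; try exact: bounded_measurableZ.
by ring.
Qed.

(** The lower bound on a makes w^(-p) negligible against w^(a - 2). Error budget: eps / 6 for the
    Poisson equation, eps / 6 for the limits of the kernel, eps / 2 for the Taylor remainder. *)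
Lemma lyapunov_drift (a eps : R) : 2 - p < a -> a <= 2 -> 0 < eps ->
  exists g : S -> R, [/\ continuous g, forall u, 0 <= g u & exists r : R,
    forall z, r < z.1%:num -> exists2 D : R,
      (\int[Ks z]_y (lyapunov a g y)%:E = (lyapunov a g z + D)%:E)%E &
      `|D - (1 + z.1%:num) `^ (a - 2) * (a / 2 * delta pi e sigma2 (a / 2))| <=
        eps * (1 + z.1%:num) `^ (a - 2)].
Proof.
move=> pa a2 eps0; have eps6 : 0 < eps / 6 by rewrite divr_gt0.
pose h u := a / 2 * (2 * e u + (2 * (a / 2) - 1) * sigma2 u).
have ch : continuous h by move=> u; apply: cvgMr; exact: integrand_continuous.
have piM : mean (fun f => \int[pi]_u f u) by apply: mean_Rintegral; exact: probability_setT.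
have hE : \int[pi]_u h u = a / 2 * delta pi e sigma2 (a / 2).
  by rewrite /h (meanZ piM)//; exact: continuous_bounded_measurable.
have [g [cg g0] gP] :=
  approximate_poisson_equation compactS K_continuous pi_invariant ch eps6.
exists g; split => //.
have [C C0 HC] := lyapunov_increment compactS p_gt2 p_le3 B_ge0 moment a2 cg.
pose c := a * (a - 1) / 2.
(* The three limits enter the drift with coefficients a, c and 1. *)
pose eta := eps / 6 / (1 + `|a| + `|c|).
have ac0 : 0 < 1 + `|a| + `|c| by rewrite -addrA ltr_pwDl// addr_ge0.
have eta0 : 0 < eta by rewrite divr_gt0.
have [_ be] := continuous_bounded_measurable compactS e_continuous.
have [r1 r1P] := moment_limits p_gt2 moment Ks_lamperti be eta0.
have [r2 r2P] := kop_marginal_limit compactS Ks_asymptotic cg eta0.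
pose eC := eps / (6 * (C + 1)).
have C1 : 0 < C + 1 by rewrite ltr_wpDl.
have eC0 : 0 < eC by rewrite divr_gt0// mulr_gt0.
have p2 : 0 < p - 2 by rewrite subr_gt0.
have pa2 : 0 < p + a - 2.
  by rewrite (_ : p + a - 2 = a - (2 - p)) ?subr_gt0//; ring.
have [r3 r3P] := powRN_small p2 eC0.
have [r4 r4P] := powRN_small pa2 eC0.
have [r5 r5P] := powRN_small (@ltr01 R) eC0.
exists (Num.max (Num.max (Num.max r1 r2) xB) (Num.max (Num.max r3 r4) r5)) => z.
rewrite !gt_max => /andP[/andP[/andP[z1 z2] z0] /andP[/andP[z3 z4] z5]].
set w := 1 + z.1%:num.
have w1 : 1 <= w by exact: radius_ge1.
have zw : z.1%:num < w by rewrite /w ltrDr.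
have wne0 : w != 0 by rewrite gt_eqF// (lt_le_trans _ w1).
have [iV HV] := HC z (ltW z0).
have [m1P m2P] := r1P z z1.
have gzP := r2P z z2.
exists (kop Ks (lyapunov a g) z - lyapunov a g z).
  by rewrite addrC subrK /kop /Rintegral fineK//; exact: integrable_fin_num.
rewrite -/w -/c in HV *; set m1 := kop Ks _ z in m1P.
set m2 := kop Ks _ z in m2P; set gz := kop Ks _ z in gzP.
rewrite -/m1 -/m2 -/gz in HV.
set wb := w `^ (a - 2) in HV *.
have wb0 : 0 <= wb by exact: powR_ge0.
have w_a1 : w `^ (a - 1) = wb * w.
  rewrite /wb -[X in _ * X]powRr1 ?(le_trans ler01)// -powRD ?wne0 ?implybT//.
  by congr (_ `^ _); ring.
(* Relative to w^(a - 2) the remainder consists of three negative powers of w, each at most [eC]. *)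
have w_rem : (w `^ a + 1) * w `^ (- p) + w `^ (a - 3) =
    wb * (w `^ (- (p - 2)) + w `^ (- (p + a - 2)) + w `^ (- 1)).
  rewrite /wb !mulrDr -!powRD ?wne0 ?implybT// mulrDl mul1r -powRD ?wne0 ?implybT//.
  by congr (_ + _ + _); congr (_ `^ _); ring.
rewrite w_a1 w_rem in HV.
have H3 := r3P _ (lt_trans z3 zw).
have H4 := r4P _ (lt_trans z4 zw).
have H5 := r5P _ (lt_trans z5 zw).
have rem_small : C * (wb * (w `^ (- (p - 2)) + w `^ (- (p + a - 2)) + w `^ (- 1))) <=
    wb * (eps / 2).
  rewrite mulrCA ler_wpM2l//.
  apply: (@le_trans _ _ (C * (3 * eC))); first by rewrite ler_wpM2l//; lra.
  apply: (@le_trans _ _ ((C + 1) * (3 * eC))).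
    by rewrite ler_wpM2r ?lerDl// mulr_ge0// ltW.
  by rewrite le_eqVlt; apply/orP; left; apply/eqP; rewrite /eC; field; rewrite gt_eqF.
pose X := a * (w * m1) + c * m2 + (gz - g z.2).
have HVX : `|kop Ks (lyapunov a g) z - lyapunov a g z - wb * X| <= wb * (eps / 2).
  apply: le_trans rem_small; apply: le_trans HV; rewrite le_eqVlt; apply/orP; left.
  by apply/eqP; congr (`|_|); rewrite /X /c; ring.
have XP : `|X - a / 2 * delta pi e sigma2 (a / 2)| <= eps / 2.
  (* The averaging: K g - g cancels the oscillation of h around pi(h). *)
  have -> : X - a / 2 * delta pi e sigma2 (a / 2) =
    a * (w * m1 - e z.2) + c * (m2 - sigma2 z.2) + (gz - kop K g z.2) -
    (g z.2 - kop K g z.2 - (h z.2 - \int[pi]_x h x)).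
    by rewrite hE /X /h /c; field.
  have E : (1 + `|a| + `|c|) * eta = eps / 6 by rewrite /eta mulrC divfK// gt_eqF.
  apply: le_trans (ler_normB _ _) _.
  apply: (@le_trans _ _ (eps / 6 + eps / 6)); last by lra.
  apply: lerD; last exact: gP.
  rewrite -E; apply: le_trans (ler_normD _ _) _.
  rewrite [leRHS](_ : _ = `|a| * eta + `|c| * eta + eta); last by ring.
  apply: lerD => //; apply: le_trans (ler_normD _ _) _.
  by rewrite !normrM; apply: lerD; exact: ler_wpM2l.
set Dz := kop Ks (lyapunov a g) z - lyapunov a g z in HVX *.
set de := a / 2 * delta pi e sigma2 (a / 2) in XP *.
have -> : Dz - wb * de = (Dz - wb * X) + wb * (X - de) by ring.
apply: le_trans (ler_normD _ _) _; rewrite (_ : eps * wb = wb * (eps / 2) + wb * (eps / 2)).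
  by apply: lerD => //; rewrite normrM (ger0_norm wb0); exact: ler_wpM2l.
by field.
Qed.

End asymptotic_drift.

Section kernel_moments.
Context (R : realType) (dO : measure_display) (Omega : measurableType dO)
  (P : probability Omega R) (d : measure_display) (S : borelMetricType d R)
  (Ks : R.-pker (half_strip R S) ~> (half_strip R S)) (z : half_strip R S)
  (F : nat -> set_system Omega) (xi : nat -> Omega -> half_strip R S).
Hypothesis mp : markov_process P Ks z F xi.

(** At time 0 the state is deterministic, so the conditional bound becomes a bound on the kernel at
    z; a process starts from every z. *)
Lemma kernel_moment (p q xB Bp Bq : R) : moment_bounds P F xi p q xB Bp Bq ->
  xB <= z.1%:num ->
  (\int[Ks z]_y (`|y.1%:num - z.1%:num| `^ p)%:E <= `|Bp|%:E)%E.
Proof.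
move=> /(_ 0%N)[[Y [mY YE] YB] _] zB.
pose f (y : half_strip R S) : R := `|y.1%:num - z.1%:num| `^ p.
have mf : measurable_fun setT (EFin \o f).
  by apply/measurable_EFinP; exact: measurable_increment_powR.
have f0 y : (0 <= (EFin \o f) y)%E by rewrite lee_fin powR_ge0.
have := markov_integral mp (filtrationT mp 0) mf f0.
under [in RHS]eq_integral do rewrite (mp_initial mp).
have -> c : (\int[P]_(w in setT) c = c)%E.
  by rewrite integral_cst// -[RHS]mule1; congr (_ * _)%E; exact: probability_setT.
move=> <-.
have <- : (\int[P]_w Y w = \int[P]_w (f (xi 1%N w))%:E)%E.
  rewrite YE; last exact: filtrationT mp 0.
  by apply: eq_integral => w _; rewrite /f /radial (mp_initial mp).
have mYT : measurable_fun setT Y.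
  by move=> _ A mA; rewrite setTI; apply: (filtration_measurable mp (n := 0)); exact: mY.
(* A version [Y] is not assumed nonnegative; its positive part is compared with |Bp|. *)
apply: (@le_trans _ _ (\int[P]_w (Y^\+ w))%E).
  rewrite integralE -[leRHS]adde0; apply: leeD2l; rewrite oppe_le0.
  exact: integral_ge0.
apply: (@le_trans _ _ (\int[P]_w `|Bp|%:E)%E).
  apply: ae_ge0_le_integral => //.
  - exact: measurable_funepos.
  - apply: filterS YB => w Yw _; rewrite funeposE ge_max lee_fin normr_ge0 andbT.
    apply: le_trans (Yw _) _; first by rewrite /= /radial (mp_initial mp).
    by rewrite lee_fin ler_norm.
rewrite integral_cst// -[leRHS]mule1; apply: lee_wpmul2l => //.
exact: probability_le1.
Qed.

End kernel_moments.

(** * Classification *)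

Section power_comparisons.
Context (R : realType).
Implicit Types a s w M : R.

Lemma powR_unbounded a M : 0 < a -> exists L, forall w, L < w -> M <= w `^ a.
Proof.
move=> a0; have M0 : 0 < (`|M| + 1)^-1 by rewrite invr_gt0 ltr_wpDl.
have [L LP] := powRN_small a0 M0; exists (Num.max L 0) => w.
rewrite gt_max => /andP[Lw w0]; have := LP w Lw.
rewrite powRN lef_pV2 ?posrE ?powR_gt0 ?ltr_wpDl//; apply: le_trans.
by rewrite (le_trans (ler_norm M))// lerDl.
Qed.

(** Subquadratic growth, the source of uniform integrability in the null recurrent case. *)
Lemma powR_le_square a s : 0 <= a -> a < 2 -> 0 < s ->
  exists b, forall w, 1 <= w -> w `^ a <= s * w `^ 2 + b.
Proof.
move=> a0 a2 s0; have a20 : 0 < 2 - a by lra.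
have [L LP] := powRN_small a20 s0; exists (`|L| `^ a) => w w1.
have w0 : 0 < w by lra.
have [wL|Lw] := leP w L.
  apply: (@le_trans _ _ (`|L| `^ a)); last by rewrite lerDr mulr_ge0 ?powR_ge0// ltW.
  apply: ge0_ler_powR; rewrite ?nnegrE ?(ltW w0)//.
  exact: le_trans wL (ler_norm _).
apply: (@le_trans _ _ (s * w `^ 2)); last by rewrite lerDl powR_ge0.
have -> : w `^ a = w `^ (- (2 - a)) * w `^ 2.
  have wne0 : w != 0 by rewrite gt_eqF.
  by rewrite -powRD ?wne0 ?implybT//; congr (_ `^ _); ring.
by rewrite ler_wpM2r ?powR_ge0//; exact: LP.
Qed.

End power_comparisons.

Lemma moment_le (R : realType) (d : measure_display) (S : borelMetricType d R)
    (Ks : R.-pker (half_strip R S) ~> (half_strip R S)) (z : half_strip R S) (p q B : R) :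
  0 <= q -> q <= p ->
  (\int[Ks z]_y (`|y.1%:num - z.1%:num| `^ p)%:E <= B%:E)%E ->
  (\int[Ks z]_y (`|y.1%:num - z.1%:num| `^ q)%:E <= (1 + B)%:E)%E.
Proof.
move=> q0 qp HB.
have mp r : measurable_fun setT (fun y : half_strip R S =>
    (`|y.1%:num - z.1%:num| `^ r)%:E : \bar R).
  by apply/measurable_EFinP; exact: measurable_increment_powR.
apply: (@le_trans _ _ (\int[Ks z]_y (1%:E + (`|y.1%:num - z.1%:num| `^ p)%:E))%E).
  apply: ge0_le_integral => //.
  - by apply: emeasurable_funD.
  - move=> y _; rewrite -EFinD lee_fin.
    set D := `|_|; have D0 : 0 <= D by exact: normr_ge0.
    have [D1|D1] := leP D 1; last first.
      apply: (@le_trans _ _ (D `^ p)); last by rewrite lerDr.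
      by apply: ler_powR => //; exact: ltW.
    apply: (@le_trans _ _ 1); last by rewrite lerDl powR_ge0.
    apply: (@le_trans _ _ (1 `^ q)); last by rewrite powR1.
    by apply: ge0_ler_powR; rewrite ?nnegrE.
by rewrite ge0_integralD// integral_cst// prob_kernel mule1 EFinD leeD2l.
Qed.

Theorem theorem2p2 (R : realType) (dS : measure_display)
  (S : borelMetricType dS R) (compactS : compact [set: S])
  (Ks : R.-pker (half_strip R S) ~> (half_strip R S))
  (dO : half_strip R S -> measure_display)
  (Omega : forall z, measurableType (dO z))
  (P : forall z, probability (Omega z) R)
  (F : forall z, nat -> set_system (Omega z))
  (xi : forall z, nat -> Omega z -> half_strip R S)
  (xi_markov : forall z, markov_process (P z) Ks z (F z) (xi z))
  (xi_non_confined : non_confined P xi)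
  (K : R.-pker S ~> S) (pi : probability S R)
  (pi_invariant : unique_invariant_probability K pi)
  (K_continuous : tv_continuous K)
  (Ks_asymptotic : asymptotically_markov Ks K)
  (p q xB Bp Bq : R) (p_gt2 : 2 < p) (q_gt0 : 0 < q) (xB_ge0 : 0 <= xB)
  (xi_moments : forall z, moment_bounds (P z) (F z) (xi z) p q xB Bp Bq)
  (e sigma2 : S -> R) (e_continuous : continuous e)
  (sigma2_continuous : continuous sigma2)
  (Ks_lamperti : strict_lamperti Ks e sigma2) :
  ((0 < delta pi e sigma2 0 -> transient P xi) /\
   (delta pi e sigma2 0 < 0 -> recurrent P xi)) /\
  (2 <= q ->
   (delta pi e sigma2 1 < 0 -> positive_recurrent P xi) /\
   (delta pi e sigma2 0 < 0 -> 0 < delta pi e sigma2 1 ->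
    null_recurrent P xi)).
Proof.
(* The expansions need an exponent in (2, 3]; lowering p preserves a moment bound. *)
pose p' := Num.min p 3.
have p'_gt2 : 2 < p' by rewrite lt_min p_gt2/=; lra.
have p'_le3 : p' <= 3 by rewrite ge_min lexx orbT.
have B0 : 0 <= 1 + `|Bp| by rewrite addr_ge0.
have moment (z : half_strip R S) : xB <= z.1%:num ->
    (\int[Ks z]_y (`|y.1%:num - z.1%:num| `^ p')%:E <= (1 + `|Bp|)%:E)%E.
  move=> zB; apply: (@moment_le _ _ _ _ _ p).
  - by apply: le_trans (ltW p'_gt2).
  - by rewrite ge_min lexx.
  - exact: (kernel_moment (xi_markov z) (xi_moments z) zB).
have drift := lyapunov_drift compactS pi_invariant K_continuous Ks_asymptotic
  p'_gt2 p'_le3 B0 moment e_continuous sigma2_continuous Ks_lamperti.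
pose s := \int[pi]_u sigma2 u.
have deltaE t : delta pi e sigma2 t = delta pi e sigma2 0 + 2 * t * s.
  by rewrite (delta_affine compactS pi e_continuous sigma2_continuous 0 t) subr0.
have s1 : 0 < `|s| + 1 by rewrite ltr_wpDl.
have continuous_bound (g : S -> R) : continuous g -> (forall u, 0 <= g u) ->
    exists2 G, 0 <= G & forall u, 0 <= g u <= G.
  move=> cg g0; have [_ [G gG]] := continuous_bounded_measurable compactS cg.
  by exists G => [|u]; [exact: le_trans (normr_ge0 _) (gG point)|
    rewrite g0/= (le_trans (ler_norm _))].
(* Moving theta by t / 2 moves delta by t s; this bound on t preserves its sign. *)
have small_product t c : 0 < c -> 0 <= t -> t <= c / (2 * (`|s| + 1)) -> t * `|s| < c.
  move=> c0 t0; rewrite ler_pdivlMr ?mulr_gt0// => tc.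
  have := mulr_ge0 t0 (normr_ge0 s); nra.
have not_confined z w : ~ ~ limn_esup (fun n => (radial (xi z) n w)%:E) = +oo%E ->
    forall m M, exists k, M <= radial (xi z) (m + k) w.
  by move=> /contrapT H m M; exact: (limn_esup_pinfty_ge m M H).
have supermartingale a g r eps z : (forall u, 0 <= g u) ->
    (forall z, r < z.1%:num -> exists2 D : R,
      (\int[Ks z]_y (lyapunov a g y)%:E = (lyapunov a g z + D)%:E)%E &
      `|D - (1 + z.1%:num) `^ (a - 2) * (a / 2 * delta pi e sigma2 (a / 2))| <=
        eps * (1 + z.1%:num) `^ (a - 2)) ->
    r < z.1%:num ->
    exists2 D : R, (\int[Ks z]_y (lyapunov a g y)%:E = (lyapunov a g z + D)%:E)%E &
      (1 + z.1%:num) `^ (a - 2) * (a / 2 * delta pi e sigma2 (a / 2) - eps) <= D <=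
      (1 + z.1%:num) `^ (a - 2) * (a / 2 * delta pi e sigma2 (a / 2) + eps).
  move=> g0 H rz; have [D DE] := H z rz; rewrite ler_norml => /andP[D1 D2].
  exists D => //; apply/andP; split.
    by rewrite mulrBr; move: D1; rewrite [eps * _]mulrC; lra.
  by rewrite mulrDr; move: D2; rewrite [eps * _]mulrC; lra.
split; [split|].
- move=> d0 z.
  (* The exponent is a = -t; the first bound ensures 2 - p' < a. *)
  pose t := Num.min ((p' - 2) / 2) (delta pi e sigma2 0 / (2 * (`|s| + 1))).
  have t0 : 0 < t by rewrite lt_min !divr_gt0 ?mulr_gt0 ?subr_gt0.
  have tp : t <= (p' - 2) / 2 by rewrite ge_min lexx.
  have ts : t * `|s| < delta pi e sigma2 0.
    by apply: small_product; rewrite ?(ltW t0)// ge_min lexx orbT.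
  have dt : 0 < delta pi e sigma2 (- t / 2).
    rewrite deltaE (_ : 2 * (- t / 2) * s = - (t * s)); last by field.
    have : t * s <= t * `|s| by rewrite ler_pM2l// ler_norm.
    lra.
  (* The main term is -eps, so the upper bound on the drift is exactly 0. *)
  pose eps := t / 2 * delta pi e sigma2 (- t / 2).
  have eps0 : 0 < eps by rewrite !mulr_gt0.
  have [||g [cg g0 [r rP]]] := drift (- t) eps _ _ eps0; [lra|lra|].
  have [G G0 gG] := continuous_bound g cg g0.
  (* X_n tends to infinity when no level is revisited infinitely often, so the criterion is applied
     at arbitrarily high levels, all above r, where the drift is controlled. *)
  pose N' n : R := Num.max (Num.max r 0) n%:R.
  have escape n : (P z).-negligible (not_escaping (xi z) (N' n)).
    have N'r : r <= N' n by rewrite !le_max lexx.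
    have N'0 : 0 <= N' n by rewrite !le_max lexx orbT.
    apply: (transience_criterion (xi_markov z) (V := lyapunov (- t) g)
      (c := (1 + N' n) `^ (- t))).
    + exact: measurable_lyapunov.
    + by move=> x; exact: lyapunov_ge0.
    + move=> x /(le_lt_trans N'r) rx.
      have [D -> /andP[_ D0]] := supermartingale _ _ _ _ _ g0 rP rx.
      rewrite lee_fin gerDl; apply: le_trans D0 _.
      by rewrite (_ : - t / 2 * _ + eps = 0) ?mulr0// /eps; ring.
    + by rewrite powR_gt0// ltr_pwDl.
    + move=> x xN; apply: le_trans (lyapunov_ge _ _ g0).
      rewrite !powRN lef_pV2 ?posrE ?powR_gt0 ?ltr_pwDl//.
      by apply: ge0_ler_powR; rewrite ?nnegrE ?(ltW t0) ?addr_ge0// lerD2l.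
    + move=> c c0; have G1 : 0 < 1 + G by rewrite ltr_pwDl.
      have [L LP] := powRN_small t0 (divr_gt0 c0 G1); exists L => x Lx.
      have {}LP := LP _ (le_lt_trans Lx (_ : x.1%:num < 1 + x.1%:num)).
      apply: (@le_trans _ _ ((1 + x.1%:num) `^ (- t) * (1 + G))); last first.
        by rewrite -ler_pdivlMr//; apply: LP; rewrite ltrDr.
      rewrite mulrDr mulr1 lerD2l; apply: ler_pM; rewrite ?powR_ge0//.
        by apply: ler_powR; [exact: radius_ge1|lra].
      by have /andP[] := gG x.2.
  have := negligibleU (xi_non_confined z) (negligible_bigcup escape).
  apply: negligibleS => w; apply: contra_notP => /not_orP[/not_confined wM nesc].
  apply/cvgryPge => A; apply: contrapT => nA; apply: nesc.
  exists (Num.truncn A).+1 => //; split=> // m; apply: contrapT => /forallNP H.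
  apply: nA; exists m => // n /= mn; have /negP := H (n - m)%N.
  rewrite subnKC// -ltNge => /ltW; apply: le_trans.
  by rewrite le_max; apply/orP; right; exact/ltW/truncnS_gt.
- move=> d0.
  pose t := Num.min 1 (- delta pi e sigma2 0 / (2 * (`|s| + 1))).
  have d0' : 0 < - delta pi e sigma2 0 by rewrite oppr_gt0.
  have t0 : 0 < t by rewrite lt_min ltr01 divr_gt0// mulr_gt0.
  have t1 : t <= 1 by rewrite ge_min lexx.
  have ts : t * `|s| < - delta pi e sigma2 0.
    by apply: small_product; rewrite ?(ltW t0)// ge_min lexx orbT.
  have dt : delta pi e sigma2 (t / 2) < 0.
    rewrite deltaE (_ : 2 * (t / 2) * s = t * s); last by field.
    have : t * s <= t * `|s| by rewrite ler_pM2l// ler_norm.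
    lra.
  pose eps := - (t / 2 * delta pi e sigma2 (t / 2)).
  have eps0 : 0 < eps by rewrite oppr_gt0 pmulr_rlt0// divr_gt0.
  have [||g [cg g0 [r rP]]] := drift t eps _ _ eps0; [lra|lra|].
  have [G G0 gG] := continuous_bound g cg g0.
  exists (Num.max r 0) => [|z]; first by rewrite le_max lexx orbT.
  have above_null : (P z).-negligible (eventually_above (xi z) (Num.max r 0)).
    apply: (recurrence_criterion (xi_markov z) (V := lyapunov t g)).
    + exact: measurable_lyapunov.
    + by move=> x; exact: lyapunov_ge0.
    + move=> x; rewrite /= gt_max => /andP[rx _].
      have [D -> /andP[_ D0]] := supermartingale _ _ _ _ _ g0 rP rx.
      rewrite lee_fin gerDl; apply: le_trans D0 _.
      by rewrite (_ : t / 2 * _ + eps = 0) ?mulr0// /eps; ring.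
    + move=> M; have [L LP] := powR_unbounded M t0; exists L => x Lx.
      apply: le_trans (lyapunov_ge _ _ g0); apply: LP.
      by apply: le_lt_trans Lx _; rewrite ltrDr.
    + move=> N; exists ((1 + `|N|) `^ t + G) => x xN.
      apply: (le_trans (@lyapunov_le _ _ _ t g G x _ gG)); first by lra.
      rewrite lerD2r; apply: ge0_ler_powR; rewrite ?nnegrE ?(ltW t0) ?addr_ge0//.
      by rewrite lerD2l; exact: le_trans xN (ler_norm N).
  have := negligibleU (xi_non_confined z) above_null.
  apply: negligibleS => w; apply: contra_notP => /not_orP[/not_confined wM nab].
  apply: (limn_einf_le (u := fun n => radial (xi z) n w)) => m.
  apply: contrapT => /forallNP H; apply: nab.
  by split=> //; exists m => k; rewrite ltNge; apply/negP; exact: H.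
move=> _; split.
(* With a = 2 the factor (1 + x)^(a - 2) is 1, and the drift is at most delta_1 + eps = -eps. *)
- move=> d1; pose eps := - delta pi e sigma2 1 / 2.
  have eps0 : 0 < eps by rewrite divr_gt0// oppr_gt0.
  have [||g [cg g0 [r rP]]] := drift 2 eps _ _ eps0; [lra|lra|].
  exists (Num.max r 0) => [|r' rr' z]; first by rewrite le_max lexx orbT.
  apply: (foster_criterion (xi_markov z) (V := lyapunov 2 g) (e := eps)) => //.
  + exact: measurable_lyapunov.
  + by move=> x; exact: lyapunov_ge0.
  + move=> x; rewrite /= => r'x; have rx : r < x.1%:num.
      by apply: le_lt_trans r'x; apply: le_trans rr'; rewrite le_max lexx.
    have [D -> /andP[_ D0]] := supermartingale _ _ _ _ _ g0 rP rx.
    rewrite -EFinD lee_fin; move: D0.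
    rewrite subrr powRr0 divff// !mul1r /eps; lra.
- move=> _ d1 r r0.
  pose t := Num.min 1 (delta pi e sigma2 1 / (2 * (`|s| + 1))).
  have t0 : 0 < t by rewrite lt_min ltr01 divr_gt0// mulr_gt0.
  have t1 : t <= 1 by rewrite ge_min lexx.
  have ts : t * `|s| < delta pi e sigma2 1.
    by apply: small_product; rewrite ?(ltW t0)// ge_min lexx orbT.
  pose a := 2 - t.
  have da : 0 < delta pi e sigma2 (a / 2).
    have -> : delta pi e sigma2 (a / 2) = delta pi e sigma2 1 - t * s.
      by rewrite deltaE (deltaE 1) /a; field.
    have : t * s <= t * `|s| by rewrite ler_pM2l// ler_norm.
    lra.
  have a0 : 0 < a by rewrite /a; lra.
  have a2 : a < 2 by rewrite /a; lra.
  pose eps := a / 2 * delta pi e sigma2 (a / 2).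
  have eps0 : 0 < eps by rewrite mulr_gt0// divr_gt0.
  have [||g [cg g0 [rV rVP]]] := drift a eps _ _ eps0; [rewrite /a; lra|exact: ltW|].
  (* The quadratic function only needs a bounded drift, at most |delta_1| + 1. *)
  have [||g' [cg' g'0 [rW rWP]]] := drift 2 1 _ _ ltr01; [lra|lra|].
  have [G G0 gG] := continuous_bound g cg g0.
  pose r' := Num.max r (Num.max rV rW).
  have r'0 : 0 <= r' by rewrite le_max r0.
  (* Starting beyond [L], the function exceeds its maximal value (1 + r')^a + G below level r'; the
     1 makes this strict. *)
  have [L LP] := powR_unbounded ((1 + r') `^ a + G + 1) a0.
  exists (Num.max r' L + 1) => [|z zr].
    by rewrite ltr_pwDr// !le_max lexx.
  have [zr' zL] : r' < z.1%:num /\ L < z.1%:num.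
    by apply/andP; rewrite -gt_max; apply: lt_trans zr; rewrite ltrDl.
  (* As r <= r', tau_r is at least tau_r', so it suffices to treat the higher level, above which
     both drift estimates hold. *)
  suff : (\int[P z]_w hitting_time (xi z) r' w)%E = +oo%E.
    move=> H; apply/eqP; rewrite -leye_eq -H; apply: ge0_le_integral => //.
    + by move=> w _; exact: hitting_time_ge0.
    + exact: (measurable_hitting_time (xi_markov z)).
    + exact: (measurable_hitting_time (xi_markov z)).
    + by move=> w _; apply: le_hitting_time; rewrite le_max lexx.
  apply: (null_criterion (xi_markov z) (V := lyapunov a g) (W := lyapunov 2 g')
    (c := `|delta pi e sigma2 1| + 1) (v := (1 + r') `^ a + G)).
  + exact: measurable_lyapunov.
  + by move=> x; exact: lyapunov_ge0.
  + exact: measurable_lyapunov.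
  + by move=> x; exact: lyapunov_ge0.
  + move=> x; rewrite /= !gt_max => /and3P[_ rVx _].
    have [D -> /andP[D0 _]] := supermartingale _ _ _ _ _ g0 rVP rVx.
    rewrite lee_fin lerDl; apply: le_trans D0.
    by rewrite (_ : a / 2 * _ - eps = 0) ?mulr0// /eps; ring.
  + by rewrite addr_ge0.
  + move=> x; rewrite /= !gt_max => /and3P[_ _ rWx].
    have [D -> /andP[_ D0]] := supermartingale _ _ _ _ _ g'0 rWP rWx.
    rewrite -EFinD lee_fin lerD2l; apply: le_trans D0 _.
    by rewrite subrr powRr0 divff// !mul1r lerD2r ler_norm.
  + move=> c c0; have [b bP] := powR_le_square (ltW a0) a2 c0.
    exists (b + G) => x; apply: (le_trans (@lyapunov_le _ _ _ a g G x (ltW a2) gG)).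
    rewrite addrA lerD2r; apply: le_trans (bP _ (radius_ge1 x)) _.
    by rewrite lerD2r ler_wpM2l ?(ltW c0)//; exact: lyapunov_ge.
  + move=> x xr; apply: (le_trans (@lyapunov_le _ _ _ a g G x (ltW a2) gG)).
    by rewrite lerD2r; apply: ge0_ler_powR; rewrite ?nnegrE ?(ltW a0) ?addr_ge0// lerD2l.
  + by rewrite addr_ge0// powR_ge0.
  + apply: lt_le_trans (lyapunov_ge _ _ g0).
    apply: (@lt_le_trans _ _ ((1 + r') `^ a + G + 1)); first by rewrite ltrDl.
    by apply: LP; apply: lt_trans zL _; rewrite ltrDr.
Qed.
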